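(* Let $E$ be the elliptic curve $X_1(14)$ over $\mathbb{Q}$, with Weierstrass model $y^2=x^3-11x^2+32x$. Let $p$ be a prime with $p\equiv 3\pmod 8$ and $\left(\frac{p}{7}\right)=1$. Then the quadratic twists $E^{(p)}$ and $E^{(-7p)}$ both have rank $0$ over $\mathbb{Q}$, i.e. $\operatorname{rank}E^{(p)}(\mathbb{Q})=\operatorname{rank}E^{(-7p)}(\mathbb{Q})=0$.
   Context: $X_1(14)$ is the modular curve classifying elliptic curves with a point of order $14$; it is an elliptic curve over $\mathbb{Q}$. For an elliptic curve $y^2=x^3+ax^2+bx$ and $d\in\mathbb{Q}^*$, its quadratic twist by $d$ is $E^{(d)}:y^2=x^3+adx^2+bd^2x$. $\left(\frac{p}{7}\right)$ is the Legendre symbol. *)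

(* Defs.v *)
From HB Require Import structures.
From mathcomp Require Import all_boot all_order all_algebra.
From mathcomp Require Import ring.

Set Implicit Arguments.
Unset Strict Implicit.
Unset Printing Implicit Defensive.

Import Order.TTheory GRing.Theory Num.Theory.
Local Open Scope ring_scope.

(* The curve y^2 = x^3 + a x^2 + b x over a field of characteristic 0;
   16 b^2 (a^2 - 4 b) is the discriminant of this model. *)
Record ellcurve (F : numFieldType) := EllCurve {
  ella : F;
  ellb : F;
  ell_nonsing : 16 * ellb ^+ 2 * (ella ^+ 2 - 4 * ellb) != 0 }.

(* [None] is the point at infinity, [Some (x, y)] an affine point. *)
Definition on_curve (F : numFieldType) (E : ellcurve F) (P : option (F * F)) :=
  if P is Some (x, y) then y ^+ 2 == x ^+ 3 + ella E * x ^+ 2 + ellb E * x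
  else true.

Record point (F : numFieldType) (E : ellcurve F) := Point {
  point_val : option (F * F);
  point_valP : on_curve E point_val }.

HB.instance Definition _ (F : numFieldType) (E : ellcurve F) :=
  [isSub for @point_val F E].
HB.instance Definition _ (F : numFieldType) (E : ellcurve F) :=
  [Choice of point E by <:].

Section GroupLaw.

Variables (F : numFieldType) (E : ellcurve F).
Local Notation a := (ella E).
Local Notation b := (ellb E).
Implicit Types P Q R : option (F * F).

(* Slope of the line through (x1, y1) and (x2, y2), or of the tangent line at
   (x1, y1) when the two points coincide. *)
Definition slope (x1 y1 x2 y2 : F) : F :=
  if x1 == x2 then (3 * x1 ^+ 2 + 2 * a * x1 + b) / (2 * y1)
  else (y2 - y1) / (x2 - x1).

Definition opp_pt P := if P is Some (x, y) then Some (x, - y) else None.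

Definition add_pt P Q :=
  match P, Q with
  | None, _ => Q
  | _, None => P
  | Some (x1, y1), Some (x2, y2) =>
      if (x1 == x2) && (y1 == - y2) then None
      else let l := slope x1 y1 x2 y2 in
           let x3 := l ^+ 2 - a - x1 - x2 in
           Some (x3, l * (x1 - x3) - y1)
  end.

(* Uniform characterization of [slope]: the first equation determines l when
   x1 != x2, the second one when y1 != - y2. *)
Definition is_slope (x1 y1 x2 y2 l : F) :=
  l * (x1 - x2) = y1 - y2 /\
  l * (y1 + y2) = x1 ^+ 2 + x1 * x2 + x2 ^+ 2 + a * (x1 + x2) + b.

Let two0 : (2 : F) != 0. Proof. by rewrite pnatr_eq0. Qed.

Lemma y_cases x y1 y2 :
  on_curve E (Some (x, y1)) -> on_curve E (Some (x, y2)) ->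
  y1 = y2 \/ y1 = - y2.
Proof.
move=> /eqP h1 /eqP h2; have : (y1 - y2) * (y1 + y2) = 0.
  by rewrite -subr_sqr h1 h2 subrr.
move/eqP; rewrite mulf_eq0 subr_eq0 addr_eq0.
by case/orP=> /eqP; [left | right].
Qed.

Lemma slopeP x1 y1 x2 y2 :
  on_curve E (Some (x1, y1)) -> on_curve E (Some (x2, y2)) ->
  ~~ ((x1 == x2) && (y1 == - y2)) ->
  is_slope x1 y1 x2 y2 (slope x1 y1 x2 y2).
Proof.
rewrite /is_slope /slope; have [->|ne] := eqVneq x1 x2 => /= h1 h2.
  move=> ny; case: (y_cases h1 h2) ny => ->; last by rewrite eqxx.
  move=> ny; have y0 : y2 != 0.
    by apply: contraNneq ny => ->; rewrite oppr0.
  split; first by rewrite !subrr mulr0.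
  by field; rewrite ?y0 ?two0.
move: h1 h2 => /eqP h1 /eqP h2 _; have d0 : x2 - x1 != 0.
  by rewrite subr_eq0 eq_sym.
split; first by field.
apply: (mulIf d0); rewrite mulrAC divfK //.
transitivity (y2 ^+ 2 - y1 ^+ 2); first by ring.
by rewrite h1 h2; ring.
Qed.

Lemma is_slope_uniq x1 y1 x2 y2 l m : ~~ ((x1 == x2) && (y1 == - y2)) ->
  is_slope x1 y1 x2 y2 l -> is_slope x1 y1 x2 y2 m -> l = m.
Proof.
rewrite negb_and -subr_eq0 -addr_eq0 => /orP n [l1 l2] [m1 m2].
by case: n => n; apply: (mulIf n); rewrite ?l1 ?m1 ?l2 ?m2.
Qed.

Lemma add_ptE x1 y1 x2 y2 l :
  on_curve E (Some (x1, y1)) -> on_curve E (Some (x2, y2)) ->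
  ~~ ((x1 == x2) && (y1 == - y2)) -> is_slope x1 y1 x2 y2 l ->
  let x3 := l ^+ 2 - a - x1 - x2 in
  add_pt (Some (x1, y1)) (Some (x2, y2)) = Some (x3, l * (x1 - x3) - y1).
Proof.
move=> h1 h2 n hl /=; rewrite (negPf n).
by rewrite (is_slope_uniq n hl (slopeP h1 h2 n)).
Qed.

Lemma is_slopeC x1 y1 x2 y2 l :
  is_slope x1 y1 x2 y2 l -> is_slope x2 y2 x1 y1 l.
Proof.
case=> h1 h2; split; first by rewrite -opprB mulrN h1 opprB.
by rewrite addrC h2; ring.
Qed.

Lemma add_ptN (x1 y1 x2 y2 : F) :
  (x1 == x2) && (y1 == - y2) = ((x2 == x1) && (y2 == - y1)).
Proof. by rewrite eq_sym; congr andb; rewrite -eqr_oppLR eq_sym. Qed.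

Lemma on_opp P : on_curve E P -> on_curve E (opp_pt P).
Proof. by case: P => [[x y]|] //=; rewrite sqrrN. Qed.

Lemma on_add P Q : on_curve E P -> on_curve E Q -> on_curve E (add_pt P Q).
Proof.
case: P => [[x1 y1]|] //; case: Q => [[x2 y2]|] // h1 h2.
have [e|n] := boolP ((x1 == x2) && (y1 == - y2)); first by rewrite /= e.
have hl := slopeP h1 h2 n; rewrite (add_ptE h1 h2 n hl).
move: (slope _ _ _ _) hl => l [l1 l2].
move: h1 => /eqP h1; apply/eqP.
have e2 : y2 = y1 - l * (x1 - x2) by rewrite l1; ring.
subst y2.
have eb : b = l * (y1 + (y1 - l * (x1 - x2)))
   - (x1 ^+ 2 + x1 * x2 + x2 ^+ 2 + a * (x1 + x2)) by rewrite l2; ring.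
apply/eqP; rewrite -subr_eq0; apply/eqP.
have -> : 0 = y1 ^+ 2 - (x1 ^+ 3 + a * x1 ^+ 2 + b * x1) by rewrite h1 subrr.
by rewrite eb; ring.
Qed.

Lemma add_ptC P Q : on_curve E P -> on_curve E Q -> add_pt P Q = add_pt Q P.
Proof.
case: P => [[x1 y1]|]; case: Q => [[x2 y2]|] // h1 h2.
have [e|n] := boolP ((x1 == x2) && (y1 == - y2)).
  by rewrite /= e add_ptN e.
have hl := slopeP h1 h2 n; rewrite (add_ptE h1 h2 n hl).
rewrite add_ptN in n.
rewrite (add_ptE h2 h1 n (is_slopeC hl)).
move: (slope _ _ _ _) hl => l [l1 l2].
have e2 : y2 = y1 - l * (x1 - x2) by rewrite l1; ring.
by rewrite e2; congr (Some (_, _)); ring.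
Qed.

Lemma add_ptNP P : add_pt (opp_pt P) P = None.
Proof. by case: P => [[x y]|] //=; rewrite !eqxx. Qed.

Lemma opp_ptK P : opp_pt (opp_pt P) = P.
Proof. by case: P => [[x y]|] //=; rewrite opprK. Qed.

Lemma opp_add P Q : on_curve E P -> on_curve E Q ->
  opp_pt (add_pt P Q) = add_pt (opp_pt P) (opp_pt Q).
Proof.
case: P => [[x1 y1]|] //; case: Q => [[x2 y2]|] // h1 h2.
have [e|n] := boolP ((x1 == x2) && (y1 == - y2)).
  by rewrite /= eqr_opp e.
have hl := slopeP h1 h2 n; rewrite (add_ptE h1 h2 n hl).
move: (slope _ _ _ _) hl => l [l1 l2].
rewrite [opp_pt (Some (x1, _))]/= [opp_pt (Some (x2, _))]/=.
rewrite (@add_ptE _ _ _ _ (- l)) ?(on_opp h1) ?(on_opp h2) ?eqr_opp //=.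
  by congr (Some (_, _)); ring.
by split; rewrite mulNr ?l1 -?mulrN ?opprD ?opprK -?l2; ring.
Qed.

(* Nonsingularity: the partial derivatives do not both vanish. *)
Lemma nonsing x : on_curve E (Some (x, 0)) ->
  3 * x ^+ 2 + 2 * a * x + b != 0.
Proof.
move/eqP => h; apply/eqP => d; case/eqP: (ell_nonsing E).
have eb : b = - (3 * x ^+ 2 + 2 * a * x).
  by apply/eqP; rewrite -addr_eq0 addrC d.
have : x ^+ 2 * (2 * x + a) = 0.
  transitivity (- (x ^+ 3 + a * x ^+ 2 + b * x)); first by rewrite eb; ring.
  by rewrite -h expr0n oppr0.
rewrite eb => /eqP; rewrite mulf_eq0 => /orP[|/eqP h'].
  by rewrite sqrf_eq0 => /eqP->; ring.
have -> : a = - (2 * x) by apply/eqP; rewrite -addr_eq0 addrC h'.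
by ring.
Qed.

Lemma add_ptKN P Q : on_curve E P -> on_curve E Q ->
  add_pt (opp_pt P) (add_pt P Q) = Q.
Proof.
case: P => [[x1 y1]|]; last by case: Q.
case: Q => [[x2 y2]|]; last by rewrite [add_pt _ None]/= add_ptNP.
move=> h1 h2.
have [e|n] := boolP ((x1 == x2) && (y1 == - y2)).
  by rewrite /= e; case/andP: e => /eqP-> /eqP->; rewrite opprK.
have hl := slopeP h1 h2 n; have h3 := on_add h1 h2.
rewrite (add_ptE h1 h2 n hl) in h3 *.
move: (slope _ _ _ _) hl h3 => l [l1 l2].
set x3 := _ - _ - _ - _; set y3 := _ - _ => h3.
have e2 : y2 = y1 - l * (x1 - x2) by rewrite l1; ring.
have eb : b = l * (y1 + y2)
   - (x1 ^+ 2 + x1 * x2 + x2 ^+ 2 + a * (x1 + x2)) by rewrite l2; ring.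
have [|n3] := boolP ((x1 == x3) && (- y1 == - y3)).
  case/andP=> /eqP ex /eqP/oppr_inj ey; exfalso.
  have y10 : y1 = 0.
    move: ey; rewrite /y3 -ex subrr mulr0 sub0r => /eqP.
    by rewrite -addr_eq0 -mulr2n -mulr_natl mulf_eq0 (negPf two0) => /eqP.
  rewrite y10 in h1; case/eqP: (nonsing h1).
  rewrite eb e2 y10.
  rewrite (_ : a = l ^+ 2 - x1 - x2 - x1); first by ring.
  by rewrite [X in _ - X]ex /x3; ring.
have n3' : ~~ ((x1 == x3) && (- y1 == - y3)) by [].
rewrite [opp_pt _]/=.
rewrite (@add_ptE _ _ _ _ (- l)) ?(on_opp h1) //.
  by congr (Some (_, _)); rewrite /x3 ?e2; ring.
split; first by rewrite /y3; ring.
by rewrite eb e2 /y3 /x3; ring.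
Qed.

Lemma is_slope_assoc x1 y1 x2 y2 x3 y3 l m :
  is_slope x1 y1 x2 y2 l -> is_slope x3 y3 x2 y2 m -> l != m ->
  let xp := l ^+ 2 - a - x1 - x2 in
  is_slope xp (l * (x1 - xp) - y1) x3 y3 ((x1 - x3) / (l - m) - l).
Proof.
move=> [l1 l2] [m1 m2] nlm.
have d0 : l - m != 0 by rewrite subr_eq0.
have e1 : y1 = y2 + l * (x1 - x2) by rewrite l1; ring.
have e3 : y3 = y2 + m * (x3 - x2) by rewrite m1; ring.
have eb : b = l * (y1 + y2)
   - (x1 ^+ 2 + x1 * x2 + x2 ^+ 2 + a * (x1 + x2)) by rewrite l2; ring.
have ey : y2 = ((x1 ^+ 2 + x1 * x2 + x2 ^+ 2 + a * (x1 + x2)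
            - l ^+ 2 * (x1 - x2)) - (x3 ^+ 2 + x3 * x2 + x2 ^+ 2
            + a * (x3 + x2) - m ^+ 2 * (x3 - x2))) / (2 * (l - m)).
  apply: (canRL (mulfK _)); first by rewrite mulf_neq0.
  apply/eqP; rewrite -subr_eq0; apply/eqP.
  transitivity ((l * (y1 + y2) - (x1 ^+ 2 + x1 * x2 + x2 ^+ 2 + a * (x1 + x2) + b))
    - (m * (y3 + y2) - (x3 ^+ 2 + x3 * x2 + x2 ^+ 2 + a * (x3 + x2) + b))).
    by rewrite e1 e3; ring.
  by rewrite l2 m2; ring.
move=> xp; rewrite /xp; split; rewrite ?eb e1 e3 ey; field;
  by rewrite ?two0 ?d0.
Qed.

Lemma add_ptA P Q R : on_curve E P -> on_curve E Q -> on_curve E R ->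
  add_pt P (add_pt Q R) = add_pt (add_pt P Q) R.
Proof.
have KN A B : on_curve E A -> on_curve E B -> add_pt A (add_pt (opp_pt A) B) = B.
  by move=> hA hB; rewrite -{1}(opp_ptK A) add_ptKN ?on_opp.
have add_eq0 A B : on_curve E A -> on_curve E B -> add_pt A B = None -> B = opp_pt A.
  move=> hA hB h; rewrite -(add_ptKN hA hB) h.
  by case: (A) => [[]|].
have addp0 A : add_pt A None = A by case: A => [[]|].
have key A B C : on_curve E A -> on_curve E B -> on_curve E C ->
    add_pt (add_pt A B) C = None -> add_pt A (add_pt B C) = None.
  move=> hA hB hC h; have hAB := on_add hA hB.
  have -> := add_eq0 _ _ hAB hC h.
  rewrite (add_ptC hA hB) (opp_add hB hA) KN ?on_opp //.
  by rewrite add_ptC ?on_opp // add_ptNP.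
move=> hP hQ hR; have hPQ := on_add hP hQ; have hQR := on_add hQ hR.
have [PQ0|PQ0] := eqVneq (add_pt P Q) None.
  by rewrite PQ0 (add_eq0 _ _ hP hQ PQ0) KN.
have [QR0|QR0] := eqVneq (add_pt Q R) None.
  rewrite QR0 (add_eq0 _ _ hQ hR QR0) addp0 (add_ptC hP hQ).
  by rewrite add_ptC ?on_opp ?on_add // add_ptKN.
have [PQR0|PQR0] := eqVneq (add_pt (add_pt P Q) R) None.
  by rewrite PQR0 key.
have [PQR0'|PQR0'] := eqVneq (add_pt P (add_pt Q R)) None.
  rewrite PQR0' add_ptC // (add_ptC hP hQ) key // add_ptC ?on_add //.
  by rewrite (add_ptC hR hQ).
have [<-|nPR] := eqVneq P R.
  by rewrite (add_ptC hQ hP) add_ptC // on_add.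
case: P Q R hP hQ hR hPQ hQR PQ0 QR0 PQR0 PQR0' nPR
  => [[x1 y1]|] // [[x2 y2]|] // [[x3 y3]|] // h1 h2 h3.
have add_n u v u' v' :
    add_pt (Some (u, v)) (Some (u', v')) != None -> ~~ ((u == u') && (v == - v')).
  by apply: contra => /= ->.
move=> hPQ hQR /add_n n12 /add_n n23.
have n32 := n23; rewrite add_ptN in n32.
have sl := slopeP h1 h2 n12; have sm := slopeP h3 h2 n32.
move: hPQ hQR; rewrite (add_ptE h1 h2 n12 sl).
rewrite (add_ptC h2 h3) (add_ptE h3 h2 n32 sm).
move: (slope x1 _ _ _) (slope x3 _ _ _) sl sm => l m sl sm hPQ hQR.
move=> /add_n nA; rewrite add_ptC // => /add_n nB n13.
have [elm|nlm] := eqVneq l m.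
  exfalso; move: sl sm nA; rewrite -{}elm => - [l1 l2] [m1 m2] /negP nA.
  have e1 : y1 = y2 + l * (x1 - x2) by rewrite l1; ring.
  have e3 : y3 = y2 + l * (x3 - x2) by rewrite m1; ring.
  have : (x1 - x3) * (x1 + x2 + x3 + a - l ^+ 2) = 0.
    transitivity ((x1 ^+ 2 + x1 * x2 + x2 ^+ 2 + a * (x1 + x2) + b)
     - (x3 ^+ 2 + x3 * x2 + x2 ^+ 2 + a * (x3 + x2) + b) - l * (y1 - y3)).
      by rewrite e1 e3; ring.
    by rewrite -l2 -m2; ring.
  move/eqP; rewrite mulf_eq0 subr_eq0 => /orP[/eqP e|/eqP e].
    by case/eqP: n13; rewrite e1 e3 e.
  have ea : a = l ^+ 2 - x1 - x2 - x3.
    by apply/eqP; rewrite -subr_eq0 -e; apply/eqP; ring.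
  by apply: nA; apply/andP; split; apply/eqP; rewrite ea ?e1 ?e3; ring.
have nml : m != l by rewrite eq_sym.
have sA := is_slope_assoc sl sm nlm; have sB := is_slope_assoc sm sl nml.
rewrite (add_ptE hPQ h3 nA sA) (add_ptE hQR h1 nB sB).
case: sl sm => [l1 _] [m1 _].
have e1 : y1 = y2 + l * (x1 - x2) by rewrite l1; ring.
have e3 : y3 = y2 + m * (x3 - x2) by rewrite m1; ring.
have d0 : l - m != 0 by rewrite subr_eq0.
have d1 : m - l != 0 by rewrite subr_eq0.
by congr (Some (_, _)); rewrite ?e1 ?e3; field; rewrite d0 d1.
Qed.

Definition ezero : point E := @Point F E None isT.
Definition eopp (P : point E) : point E := Point (on_opp (point_valP P)).
Definition eadd (P Q : point E) : point E :=
  Point (on_add (point_valP P) (point_valP Q)).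

Fact eaddA : associative eadd.
Proof. by move=> P Q R; apply/val_inj/add_ptA; apply: point_valP. Qed.
Fact eaddC : commutative eadd.
Proof. by move=> P Q; apply/val_inj/add_ptC; apply: point_valP. Qed.
Fact eadd0 : left_id ezero eadd.
Proof. by move=> P; apply/val_inj. Qed.
Fact eaddN : left_inverse ezero eopp eadd.
Proof. by move=> P; apply/val_inj/add_ptNP. Qed.

End GroupLaw.

(* [point E] is the Mordell-Weil group E(F). *)
HB.instance Definition _ (F : numFieldType) (E : ellcurve F) :=
  GRing.isZmodule.Build (point E)
    (@eaddA F E) (@eaddC F E) (@eadd0 F E) (@eaddN F E).

Definition Zfree (A : zmodType) (n : nat) (v : 'I_n -> A) : Prop :=
  forall c : 'I_n -> int, \sum_(i < n) v i *~ c i = 0 -> forall i, c i = 0.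

(* The rank of an abelian group is the largest size of a Z-linearly independent
   family; [has_rank A r] also asserts that this maximum exists. *)
Definition has_rank (A : zmodType) (r : nat) : Prop :=
  (exists v : 'I_r -> A, Zfree v) /\
  forall (n : nat) (v : 'I_n -> A), Zfree v -> (n <= r)%N.

Lemma twist_nonsing (F : numFieldType) (E : ellcurve F) (d : F) : d != 0 ->
  16 * (ellb E * d ^+ 2) ^+ 2 *
    ((ella E * d) ^+ 2 - 4 * (ellb E * d ^+ 2)) != 0.
Proof.
move=> d0; rewrite (_ : _ * _ =
  16 * ellb E ^+ 2 * (ella E ^+ 2 - 4 * ellb E) * d ^+ 6); last by ring.
by rewrite mulf_neq0 ?ell_nonsing ?expf_neq0.
Qed.

Definition twist (F : numFieldType) (E : ellcurve F) (d : F) (d0 : d != 0) :=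
  EllCurve (twist_nonsing E d0).
Arguments twist {F} E d d0.

Fact X1_14_nonsing :
  16 * (32 : rat) ^+ 2 * ((-11) ^+ 2 - 4 * 32) != 0.
Proof. by []. Qed.

Definition X1_14 : ellcurve rat := EllCurve X1_14_nonsing.

(* Meaningful when q is an odd prime. *)
Definition legendre (n : int) (q : nat) : int :=
  if (q %| n)%Z then 0
  else if [exists x : 'F_q, x ^+ 2 == n%:~R] then 1 else -1.

Lemma primeQ_neq0 (p : nat) : prime p -> p%:Q != 0.
Proof. by rewrite intr_eq0; case: p. Qed.

Lemma m7primeQ_neq0 (p : nat) : prime p -> -7 * p%:Q != 0.
Proof. by move=> pp; rewrite mulf_neq0 ?primeQ_neq0. Qed.

(* Main.v *)
Require Import Defs.
From mathcomp Require Import all_boot all_order all_algebra.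
From mathcomp Require Import ring lra zify.
Set Implicit Arguments.
Unset Strict Implicit.
Import GRing.Theory Num.Theory.
Local Open Scope ring_scope.

(* Descent by 2-isogeny. With D = p or D = -7p, the twist is
   E : y^2 = x^3 - 11 D x^2 + 32 D^2 x, and it is 2-isogenous to
   E' : Y^2 = X^3 + 22 D X^2 - 7 D^2 X. On each curve the square class of the
   abscissa lies in a finite group generated by -1 and the primes dividing the
   last coefficient, and local conditions at 2, 7 and p (where -1, 2 and 7 are
   nonresidues) leave only the classes 1, 2 on E and 1, -7 on E', which are
   those of the point (0, 0) and of infinity. Hence every P in E(Q) satisfies
   P + T = 2 Q with 2 T = 0. Halving divides logarithmic heights by 4 up to a
   constant, so iterating it stays in a set of bounded height; two iterates
   share their abscissa, and P is torsion. *)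

(** * Heights of rational numbers *)

Definition height (x : rat) : nat := maxn `|numq x| `|denq x|.

(** Cancelling a common factor can only shrink numerator and denominator. *)
Lemma height_frac (m n : int) :
  n != 0 -> (height (m%:Q / n%:Q) <= maxn `|m| `|n|)%N.
Proof.
case: divqP => // k x k0 _; rewrite /height !abszM.
have : (0 < `|k|)%N by rewrite absz_gt0.
by move: `|k|%N `|numq x|%N `|denq x|%N => {x} c u v; nia.
Qed.

Lemma height_scale (c : int) x :
  c != 0 -> (height (c%:Q * x) <= `|c| * height x)%N.
Proof.
move=> c0; rewrite -{1}(divq_num_den x) mulrA -intrM.
apply: leq_trans (height_frac _ (denq_neq0 x)) _; rewrite /height abszM.
have : (0 < `|c|)%N by rewrite absz_gt0.
by move: `|c|%N `|numq x|%N `|denq x|%N => {c0 x} c u v; nia.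
Qed.

Lemma height_inv x : x != 0 -> (height x^-1 <= height x)%N.
Proof.
move=> x0; rewrite -{1}(divq_num_den x) invf_div.
by apply: leq_trans (height_frac _ _) _; rewrite ?numq_eq0 // maxnC.
Qed.

Lemma abszD_le (x y : int) : (`|(x + y)%R| <= `|x| + `|y|)%N.
Proof. lia. Qed.

(** The inequalities behind [height_quadratic], with [q] and [r] standing for |m^2 + a m n + b n^2|
    and |m n|. With h = max(m, n) and H = max(M, N) they give h^3 <= (2 + a + b) b H h, and one
    factor h cancels. *)
Lemma height_quadratic_bound (q r m n a b M N : nat) :
  (m ^ 3 <= m * q + (a * m + b * n) * r -> n ^ 3 <= n * q + (m + a * n) * r ->
   q <= b * M -> r <= b * N -> 0 < n -> 0 < b ->
   maxn m n ^ 2 <= (2 + a + b) * b * maxn M N)%N.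
Proof.
move=> hm hn hq hr n0 b0.
set h := maxn m n; set H := maxn M N.
have mh : (m <= h)%N by rewrite leq_maxl.
have nh : (n <= h)%N by rewrite leq_maxr.
have qH : (q <= b * H)%N by apply: leq_trans hq _; rewrite leq_mul2l leq_maxl orbT.
have rH : (r <= b * H)%N by apply: leq_trans hr _; rewrite leq_mul2l leq_maxr orbT.
have bm : (m * q + (a * m + b * n) * r <= (h + (a * h + b * h)) * (b * H))%N.
  by rewrite [leqRHS]mulnDl leq_add // leq_mul // leq_add // leq_mul2l ?mh ?nh orbT.
have bn : (n * q + (m + a * n) * r <= (h + (h + a * h)) * (b * H))%N.
  by rewrite [leqRHS]mulnDl leq_add // leq_mul // leq_add // leq_mul2l ?nh orbT.
have h0 : (0 < h)%N by apply: leq_trans nh.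
rewrite -(leq_pmul2r h0) -expnSr.
have [e|e] : h = m \/ h = n by rewrite /h /maxn; case: ifP; auto.
  rewrite {1}e; apply: leq_trans hm (leq_trans bm _).
  by rewrite -(mulnA _ b) mulnAC leq_mul2r !mulnDl; apply/orP; right; lia.
rewrite {1}e; apply: leq_trans hn (leq_trans bn _).
by rewrite -(mulnA _ b) mulnAC leq_mul2r !mulnDl; apply/orP; right; lia.
Qed.

(* If x = m / n in lowest terms and x + a + b / x = M / N in lowest terms, then
   m n divides b N, and both b n^3 and m^3 are combinations of m n and
   m^2 + a m n + b n^2 with coefficients linear in m and n. *)
Lemma height_quadratic (a b : int) : b != 0 ->
  exists C : nat, forall x : rat, x != 0 ->
    (height x ^ 2 <= C * height (x + a%:Q + b%:Q / x))%N.
Proof.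
move=> b0; exists ((2 + `|a| + `|b|) * `|b|)%N => x x0.
set x' := x + _ + _; rewrite /height.
set m := numq x; set n := denq x; set M := numq x'; set N := denq x'.
have m0 : m != 0 by rewrite numq_eq0.
have n0 : n != 0 by exact: denq_neq0.
have N0 : N != 0 by exact: denq_neq0.
have cop : coprimez m n by exact: coprime_num_den.
have E : (m ^+ 2 + a * m * n + b * n ^+ 2) * N = M * (m * n).
  apply: (@intr_inj rat); rewrite !(intrD, intrM) /=.
  rewrite [M%:~R]numqE -/N /x' [m%:~R]numqE -/n.
  have n0' : n%:Q != 0 by rewrite intr_eq0.
  by field.
have dm : (m %| b * N)%Z.
  have : (m %| b * N * n ^+ 2)%Z.
    apply/dvdzP; exists (M * n - (m + a * n) * N).
    apply/eqP; rewrite -subr_eq0; move/eqP: E; rewrite -subr_eq0 => /eqP <-.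
    by apply/eqP; ring.
  by rewrite Gauss_dvdzl // coprimez_sym coprimezXl // coprimez_sym.
have dn : (n %| b * N)%Z.
  apply: dvdz_mull; have : (n %| N * m ^+ 2)%Z.
    apply/dvdzP; exists (M * m - (a * m + b * n) * N).
    apply/eqP; rewrite -subr_eq0; move/eqP: E; rewrite -subr_eq0 => /eqP <-.
    by apply/eqP; ring.
  by rewrite Gauss_dvdzl // coprimez_sym coprimezXl.
have /dvdzP[k ek] : (m * n %| b * N)%Z by rewrite Gauss_dvdz ?dm.
have ekM : (m ^+ 2 + a * m * n + b * n ^+ 2) * k = b * M.
  apply: (mulIf (mulf_neq0 m0 n0)).
  rewrite -!mulrA -ek.
  transitivity (b * ((m ^+ 2 + a * m * n + b * n ^+ 2) * N)); first by ring.
  by rewrite E; ring.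
have k0 : k != 0.
  by apply: contra_eq_neq ek => ->; rewrite mul0r mulf_neq0.
set q := m ^+ 2 + a * m * n + b * n ^+ 2 in ekM E.
(* The same integer [k] satisfies q k = b M and m n k = b N; being nonzero, it has absolute value at
   least 1. *)
have hq : (`|q| <= `|b| * `|M|)%N.
  by rewrite -abszM -ekM abszM leq_pmulr // absz_gt0.
have hr : (`|(m * n)%R| <= `|b| * `|N|)%N.
  by rewrite -[leqRHS]abszM ek [leqRHS]abszM leq_pmull // absz_gt0.
have I1 : m ^+ 3 = m * q + (- (a * m + b * n)) * (m * n) by rewrite /q; ring.
have I2 : b * n ^+ 3 = n * q + (- (m + a * n)) * (m * n) by rewrite /q; ring.
have hm : (`|m| ^ 3 <= `|m| * `|q| + (`|a| * `|m| + `|b| * `|n|) * `|(m * n)%R|)%N.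
  rewrite -!abszX I1 -!abszM; apply: leq_trans (abszD_le _ _) _.
  by rewrite leq_add2l [leqLHS]abszM leq_mul2r abszN abszD_le orbT.
have hn : (`|n| ^ 3 <= `|n| * `|q| + (`|m| + `|a| * `|n|) * `|(m * n)%R|)%N.
  apply: (@leq_trans `|(b * n ^+ 3)%R|); first by rewrite abszM abszX leq_pmull ?absz_gt0.
  rewrite I2 -!abszM; apply: leq_trans (abszD_le _ _) _.
  by rewrite leq_add2l [leqLHS]abszM leq_mul2r abszN abszD_le orbT.
have : (0 < `|b|)%N by rewrite absz_gt0.
have : (0 < `|n|)%N by rewrite absz_gt0.
move: hm hn hq hr.
move: `|q|%N `|(m * n)%R|%N `|m|%N `|n|%N `|a|%N `|b|%N `|M|%N `|N|%N.
exact: height_quadratic_bound.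
Qed.

(** * From 2-isogeny descent to rank zero *)

(** Pigeonhole on a chain of halvings: two terms share a key, hence agree up to sign, while one is
    also a power of 2 times the other up to 2-torsion. Comparing [P *+ 2] with [Q *+ 4] allows for
    halving that works only after adding a 2-torsion point. *)
Lemma torsion_of_halving (A : zmodType) (T : eqType) (key : A -> T)
    (s : seq T) (S : pred A) :
  (forall P Q, key P = key Q -> P = Q \/ P = - Q) ->
  (forall P, S P -> key P \in s) ->
  (forall P, S P -> exists2 Q, S Q & P *+ 2 = Q *+ 4) ->
  forall P, S P -> exists2 m, (0 < m)%N & P *+ m = 0.
Proof.
move=> keyP Ss half P0 S0; pose e := [rel P Q | S Q && (P *+ 2 == Q *+ 4)].
have chain n P : S P -> exists2 t, size t = n & path e P t.
  elim: n P => [|n IH] P SP; first by exists [::].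
  have [Q SQ PQ] := half P SP; have [t st et] := IH Q SQ.
  by exists (Q :: t); rewrite /= ?st // SQ PQ eqxx.
have {chain} [t st /(pathP P0) et] := chain (size s) P0 S0.
pose f i := nth P0 (P0 :: t) i.
have fS i : (i <= size s)%N -> S (f i).
  by case: i => [|i] // lti; have := et i; rewrite st => /(_ lti)/andP[].
have fe i : (i < size s)%N -> f i *+ 2 = f i.+1 *+ 4.
  by move=> lti; have := et i; rewrite st => /(_ lti)/andP[_ /eqP].
have fk k i : (i + k <= size s)%N -> f i *+ 2 = f (i + k)%N *+ (2 ^ k.+1).
  elim: k => [|k IH] h; first by rewrite addn0.
  rewrite IH; last by apply: leq_trans h; rewrite addnS.
  rewrite (expnS 2 k) mulrnA fe; last by rewrite -addnS.
  by rewrite addnS -mulrnA; congr (_ *+ _); rewrite !expnS; lia.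
(* The chain has one term more than [s] has entries. *)
have nu : ~~ uniq [seq key (f i) | i <- iota 0 (size s).+1].
  apply/negP => u; suff: ((size s).+1 <= size s)%N by rewrite ltnn.
  rewrite -[X in (X <= _)%N](size_iota 0) -(size_map (fun i => key (f i))).
  apply: uniq_leq_size u _ => x /mapP[i]; rewrite mem_iota => /andP[_ hi] ->.
  exact/Ss/fS.
have /(uniqPn (key P0))[i [j [ltij ltj]]] := nu.
rewrite size_map size_iota in ltj; have lti := ltn_trans ltij ltj.
rewrite !(nth_map 0%N) ?size_iota // !nth_iota // !add0n => kij.
have [k ek] : exists k, j = (i + k.+1)%N.
  by exists (j - i).-1; rewrite prednK ?subn_gt0 // subnKC // ltnW.
have P0i : P0 *+ 2 = f i *+ (2 ^ i.+1) by have := fk i 0%N; rewrite add0n; apply.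
have hij : f i *+ 2 = f j *+ (2 ^ k.+2) by have := fk k.+1 i; rewrite -ek; apply.
(* Substituting f i = f j or f i = - f j into [hij] shows that 2^(k+2) - 2 or 2^(k+2) + 2 kills f
   j. *)
have [m m0 fm] : exists2 m, (0 < m)%N & f j *+ m = 0.
  case: (keyP _ _ kij) hij => -> h.
    exists (2 ^ k.+2 - 2)%N; last by rewrite mulrnBr ?h ?subrr // !expnS; lia.
    by rewrite !expnS; have := expn_gt0 2 k; lia.
  exists (2 ^ k.+2 + 2)%N; first by rewrite addn_gt0 orbT.
  by rewrite mulrnDr -h mulNrn addNr.
exists (2 * m)%N; first by rewrite muln_gt0.
rewrite mulrnA P0i -mulrnA (mulnC _ m) mulrnA.
case: (keyP _ _ kij) => ->; first by rewrite fm mul0rn.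
by rewrite mulNrn fm oppr0 mul0rn.
Qed.

Lemma has_rank0_of_torsion (A : zmodType) :
  (forall P : A, exists2 m, (0 < m)%N & P *+ m = 0) -> has_rank A 0.
Proof.
move=> tors; split=> [|n v free].
  by exists (fun=> 0) => c _ [].
case: n v free => // n v free; have [m m0 vm] := tors (v ord0).
pose c (i : 'I_n.+1) : int := if i == ord0 then m%:Z else 0.
suff /free/(_ ord0) : \sum_(i < n.+1) v i *~ c i = 0.
  by rewrite /c eqxx => -[] em; rewrite em in m0.
rewrite (bigD1 ord0) //= big1 ?addr0 => [|i /negPf ni].
  by rewrite /c eqxx -pmulrn.
by rewrite /c ni mulr0z.
Qed.

(* The explicit halving.  On the isogenous curve Y^2 = X^3 + a' X^2 + b' X with
   a' = - 2 a and b' = a^2 - 4 b, the two points over (u^2, y) have abscissas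
   X = a + 2 u^2 +- 2 y / u, with product b'. When one of them is a square v^2,
   s = (v^2 - a + 2 u v) / 2 is the abscissa of a half of (u^2, y); the
   tangent there has slope u + v. *)
Lemma double_pt (E : ellcurve rat) (a b u v x y : rat) :
  a = ella E -> b = ellb E -> u != 0 -> v != 0 ->
  x = u ^+ 2 -> y ^+ 2 = x ^+ 3 + a * x ^+ 2 + b * x ->
  v ^+ 2 = a + 2 * u ^+ 2 + 2 * y / u ->
  exists s, [/\ s != 0,
    on_curve E (Some (s, s * v)),
    add_pt E (Some (s, s * v)) (Some (s, s * v)) = Some (x, y),
    v ^+ 2 = s + a + b / s &
    4 * x = v ^+ 2 + (- 2 * a) + (a ^+ 2 - 4 * b) / v ^+ 2].
Proof.
move=> aE bE u0 v0 -> hy hv.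
have ey : y = u * (v ^+ 2 - a - 2 * u ^+ 2) / 2 by rewrite hv; field.
have eb : b = ((v ^+ 2 - a) ^+ 2 - 4 * u ^+ 2 * v ^+ 2) / 4.
  have u20 : u ^+ 2 != 0 by rewrite expf_neq0.
  apply: (mulIf u20); transitivity (y ^+ 2 - (u ^+ 2) ^+ 3 - a * (u ^+ 2) ^+ 2).
    by rewrite hy; ring.
  by rewrite ey; field.
have b0 : b != 0.
  apply: contraTneq (ell_nonsing E) => e.
  by rewrite -bE e expr0n mulr0 mul0r eqxx.
pose s := (v ^+ 2 - a + 2 * u * v) / 2.
(* The conjugate of [s] under u -> -u is thus b / s. *)
have sb : s * ((v ^+ 2 - a - 2 * u * v) / 2) = b by rewrite eb /s; field.
have s0 : s != 0 by apply: contraNneq b0 => e; rewrite -sb e mul0r.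
have on : on_curve E (Some (s, s * v)).
  by rewrite /= -aE -bE -sb /s; apply/eqP; field.
exists s; split=> //.
- have hl : is_slope E s (s * v) s (s * v) (u + v).
    by split; rewrite -?aE -?bE -?sb /s; field.
  rewrite (add_ptE on on _ hl) -?aE; first by congr (Some (_, _)); rewrite ?ey /s; field.
  by rewrite eqxx /= -addr_eq0 -mulr2n -mulr_natl mulf_neq0 ?(mulf_neq0 s0).
- by rewrite -sb mulrAC divff // mul1r /s; field.
- by rewrite eb; field.
Qed.

(** The two abscissas over (u^2, y) multiply to a^2 - 4 b, so the descent on the isogenous curve
    makes one of them a square; replacing u by -u swaps them. The last two equations factor doubling
    through the two isogenies, in the form that [height_quadratic] handles. *)
Lemma half_of_square (E : ellcurve rat) (a b : rat) :
  a = ella E -> b = ellb E ->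
  (forall X Y : rat, X != 0 -> Y != 0 ->
     Y ^+ 2 = X ^+ 3 + (- 2 * a) * X ^+ 2 + (a ^+ 2 - 4 * b) * X ->
     exists v, X = v ^+ 2 \/ (a ^+ 2 - 4 * b) / X = v ^+ 2) ->
  forall u x y : rat, u != 0 -> x = u ^+ 2 ->
  y ^+ 2 = x ^+ 3 + a * x ^+ 2 + b * x ->
  exists s v, [/\ s != 0, v != 0,
    on_curve E (Some (s, s * v)),
    add_pt E (Some (s, s * v)) (Some (s, s * v)) = Some (x, y) &
    v ^+ 2 = s + a + b / s /\
    4 * x = v ^+ 2 + (- 2 * a) + (a ^+ 2 - 4 * b) / v ^+ 2].
Proof.
move=> aE bE descent u x y u0 ex hy.
have b'0 : a ^+ 2 - 4 * b != 0.
  by apply: contraTneq (ell_nonsing E) => e; rewrite -bE -aE e mulr0 eqxx.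
have hw : (y / u) ^+ 2 = u ^+ 4 + a * u ^+ 2 + b.
  by rewrite expr_div_n hy ex; field.
have eb : b = (y / u) ^+ 2 - u ^+ 4 - a * u ^+ 2 by rewrite hw; ring.
pose X := a + 2 * u ^+ 2 + 2 * y / u.
have XX : X * (a + 2 * u ^+ 2 - 2 * y / u) = a ^+ 2 - 4 * b.
  by rewrite eb /X; field.
have X0 : X != 0 by apply: contraNneq b'0 => e; rewrite -XX e mul0r.
have [v hv] : exists v, X = v ^+ 2 \/ (a ^+ 2 - 4 * b) / X = v ^+ 2.
  (* The two abscissas sum to 2 a + 4 u^2, so the ordinate over X is 2 u X. *)
  apply: (descent X (2 * u * X)); rewrite ?mulf_neq0 //.
  by rewrite -XX /X; field.
have [u' [u'0 ex' hv']] : exists u', [/\ u' != 0, x = u' ^+ 2 &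
    v ^+ 2 = a + 2 * u' ^+ 2 + 2 * y / u'].
  case: hv => hv; first by exists u; rewrite -hv.
  exists (- u); rewrite oppr_eq0 sqrrN -hv -XX; split=> //.
  by rewrite mulrAC divff // mul1r; field.
have v0 : v != 0.
  apply: contraNneq b'0 => e; rewrite e expr0n in hv.
  case: hv => /eqP; first by rewrite (negPf X0).
  by rewrite mulf_eq0 invr_eq0 (negPf X0) orbF => /eqP ->.
have [s [s0 on dbl hs hx]] := double_pt aE bE u'0 v0 ex' hy hv'.
by exists s, v; split.
Qed.

Lemma add_two_torsion (E : ellcurve rat) (a b x y : rat) :
  a = ella E -> b = ellb E -> x != 0 -> on_curve E (Some (x, y)) ->
  add_pt E (Some (x, y)) (Some (0, 0)) = Some (b / x, - (b * y) / x ^+ 2).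
Proof.
move=> aE bE x0 on.
have on0 : on_curve E (Some (0, 0)) by rewrite /= !expr0n /= !mulr0 !addr0.
have hy : y ^+ 2 = x ^+ 3 + a * x ^+ 2 + b * x by rewrite aE bE; apply/eqP.
have eb : b = y ^+ 2 / x - x ^+ 2 - a * x by rewrite hy; field.
rewrite (add_ptE on on0 _ (l := y / x)).
- by rewrite -aE; congr (Some (_, _)); rewrite eb; field.
- by rewrite (negPf x0).
- by split; rewrite -?aE -?bE ?eb; field.
Qed.

(** * Heights of points and their decrease under halving *)

Definition xcoord (E : ellcurve rat) (P : point E) : option rat :=
  omap fst (val P).

(** The value 0 at infinity makes the halving bound trivial for Q = 0. *)
Definition pt_height (E : ellcurve rat) (P : point E) : nat :=
  if xcoord P is Some x then height x else 0%N.

Lemma xcoord_inj (E : ellcurve rat) (P Q : point E) :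
  xcoord P = xcoord Q -> P = Q \/ P = - Q.
Proof.
rewrite /xcoord.
case: P Q => [[[x y]|] hP] [[[x' y']|] hQ] //= e; last by left; apply: val_inj.
case: e => e; move: hQ; rewrite -e => hQ.
case: (y_cases hP hQ) => ey; [left|right]; apply: val_inj => /=; by rewrite ey.
Qed.

(** With T = (0, 0), either P or P + T has a square abscissa and is some 2 Q, and both have the same
    double. The exponent 4 comes from [height_quadratic] applied once per isogeny: h(s)^2 <= C1
    h(v^2) and h(v^2)^2 <= C2 h(4 x). The factor |b| pays for replacing x by b / x. *)
Lemma halving_with_height (a b : int) (E : ellcurve rat) :
  a%:Q = ella E -> b%:Q = ellb E ->
  (forall x y : rat, x != 0 -> y ^+ 2 = x ^+ 3 + a%:Q * x ^+ 2 + b%:Q * x ->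
     exists u, x = u ^+ 2 \/ b%:Q / x = u ^+ 2) ->
  (forall X Y : rat, X != 0 -> Y != 0 ->
     Y ^+ 2 = X ^+ 3 + (- 2 * a%:Q) * X ^+ 2 + (a%:Q ^+ 2 - 4 * b%:Q) * X ->
     exists v, X = v ^+ 2 \/ (a%:Q ^+ 2 - 4 * b%:Q) / X = v ^+ 2) ->
  exists C : nat, forall P : point E, exists2 Q : point E,
    P *+ 2 = Q *+ 4 & (pt_height Q ^ 4 <= C * pt_height P)%N.
Proof.
move=> aE bE desc desc'; pose b' := a ^+ 2 - 4 * b.
have b'E : b'%:Q = a%:Q ^+ 2 - 4 * b%:Q by rewrite /b' rmorphB rmorphXn rmorphM.
have b0 : b != 0.
  apply: contraTneq (ell_nonsing E) => e.
  by rewrite -bE e expr0n mulr0 mul0r eqxx.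
have b'0 : b' != 0.
  apply: contraTneq (ell_nonsing E) => e.
  by rewrite -bE -aE -b'E e mulr0 eqxx.
have [C1 hC1] := height_quadratic a b0.
have [C2 hC2] := height_quadratic (- 2 * a) b'0.
exists (C1 ^ 2 * C2 * 4 * `|b|)%N => -[[[x y]|] on]; last first.
  by exists 0 => //; rewrite (_ : Point on = 0) ?mul0rn //; apply: val_inj.
have on0 : on_curve E (Some (0, 0)) by rewrite /= !expr0n /= !mulr0 !addr0.
pose T : point E := Point on0.
have T2 : T *+ 2 = 0 by apply: val_inj.
have [x0|x0] := eqVneq x 0.
  exists 0 => //; rewrite (_ : Point on = T) ?T2 ?mul0rn //.
  apply: val_inj => /=; move: on => /=; rewrite x0 !expr0n /= !mulr0 !addr0.
  by rewrite sqrf_eq0 => /eqP ->.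
have key (x' y' : rat) (on' : on_curve E (Some (x', y'))) u :
    x' != 0 -> x' = u ^+ 2 -> exists2 Q : point E, Point on' = Q *+ 2 &
      (pt_height Q ^ 4 <= C1 ^ 2 * C2 * 4 * height x')%N.
  move=> x'0 eu.
  have u0 : u != 0 by apply: contraNneq x'0 => e; rewrite eu e expr0n.
  have hy : y' ^+ 2 = x' ^+ 3 + a%:Q * x' ^+ 2 + b%:Q * x'.
    by rewrite aE bE; apply/eqP.
  have [s [v [s0 v0 ons dbl [hs hx]]]] := half_of_square aE bE desc' u0 eu hy.
  exists (Point ons); first by apply: val_inj; rewrite /= -dbl.
  rewrite /pt_height /=.
  have v20 : v ^+ 2 != 0 by rewrite expf_neq0.
  have h1 := hC1 _ s0; rewrite -hs in h1.
  have h2 := hC2 _ v20; rewrite b'E (_ : (- 2 * a)%:Q = - 2 * a%:Q) ?intrM // -hx in h2.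
  have h3 := @height_scale 4 x' isT.
  apply: (@leq_trans ((C1 * height (v ^+ 2)) ^ 2)).
    by rewrite (expnM _ 2 2) leq_exp2r.
  rewrite expnMn (_ : C1 ^ 2 * C2 * 4 * _ = C1 ^ 2 * (C2 * (4 * height x')))%N.
    rewrite leq_mul2l; apply/orP; right.
    by apply: leq_trans h2 _; rewrite leq_mul2l h3 orbT.
  by rewrite !mulnA.
have [u [hu|hu]] : exists u, x = u ^+ 2 \/ b%:Q / x = u ^+ 2.
  by apply: (desc x y x0); rewrite aE bE; apply/eqP.
  have [Q eQ hQ] := key x y on u x0 hu.
  exists Q; first by rewrite eQ -mulrnA.
  apply: leq_trans hQ _; rewrite /pt_height /=.
  by rewrite -[leqRHS]mulnA leq_mul2l leq_pmull ?orbT // absz_gt0.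
have addT := add_two_torsion aE bE x0 on.
have onT := on_add on on0; rewrite addT in onT.
have bx0 : b%:Q / x != 0 by rewrite mulf_neq0 ?invr_eq0 ?intr_eq0.
have [Q eQ hQ] := key _ _ onT u bx0 hu.
have PT : Point on + T = Point onT by apply: val_inj.
exists Q.
  by rewrite -[4%N]/(2 * 2)%N mulrnA -eQ -PT mulrnDl T2 addr0.
apply: leq_trans hQ _; rewrite /pt_height /= -[leqRHS]mulnA leq_mul2l; apply/orP; right.
apply: leq_trans (height_scale _ b0) _.
by rewrite leq_mul2l height_inv ?orbT.
Qed.

(** An explicit finite list for Northcott finiteness; the denominator 0 contributes the value 0. *)
Definition fractions_upto (B : nat) : seq rat :=
  let r := [seq i%:Z - B%:Z | i <- iota 0 (2 * B).+1] in
  [seq m%:Q / n%:Q | m <- r, n <- r].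

Lemma fractions_uptoP (B : nat) x : (height x <= B)%N -> x \in fractions_upto B.
Proof.
rewrite /height geq_max => /andP[hm hn].
have mem (m : int) : (`|m| <= B)%N ->
    m \in [seq i%:Z - B%:Z | i <- iota 0 (2 * B).+1].
  by move=> h; apply/mapP; exists `|(m + B%:Z)%R|%N; rewrite ?mem_iota; lia.
by apply/allpairsP; exists (numq x, denq x); rewrite !mem // divq_num_den.
Qed.

(** Halving preserves the set of points of height at most B = max(C, h(P0)): from h(Q)^4 <= C h(P)
    <= B^2 follows h(Q) <= B. This set has finitely many abscissas, so [torsion_of_halving] applies
    to it. *)
Theorem rank0_of_descent (a b : int) (E : ellcurve rat) :
  a%:Q = ella E -> b%:Q = ellb E ->
  (forall x y : rat, x != 0 -> y ^+ 2 = x ^+ 3 + a%:Q * x ^+ 2 + b%:Q * x ->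
     exists u, x = u ^+ 2 \/ b%:Q / x = u ^+ 2) ->
  (forall X Y : rat, X != 0 -> Y != 0 ->
     Y ^+ 2 = X ^+ 3 + (- 2 * a%:Q) * X ^+ 2 + (a%:Q ^+ 2 - 4 * b%:Q) * X ->
     exists v, X = v ^+ 2 \/ (a%:Q ^+ 2 - 4 * b%:Q) / X = v ^+ 2) ->
  has_rank (point E) 0.
Proof.
move=> aE bE desc desc'.
have [C half] := halving_with_height aE bE desc desc'.
apply: has_rank0_of_torsion => P0; pose B := maxn C (pt_height P0).
pose S : pred (point E) := [pred P | (pt_height P <= B)%N].
apply: (@torsion_of_halving _ _ (@xcoord E)
  (None :: [seq Some x | x <- fractions_upto B]) S).
- exact: xcoord_inj.
- move=> P; rewrite /S inE /pt_height in_cons; case: (xcoord P) => // x hx.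
  by apply/orP; right; apply/map_f/fractions_uptoP.
- move=> P SP; have [Q PQ hQ] := half P; exists Q => //.
  rewrite /S /= in SP *; rewrite leqNgt; apply/negP => ltB.
  have : (pt_height Q ^ 4 <= B * B)%N.
    by apply: leq_trans hQ _; rewrite leq_mul ?leq_maxl.
  have : (B * B < pt_height Q ^ 4)%N.
    by move: (pt_height Q) ltB => q ltB; rewrite !expnS expn0 muln1 mulnA;
       apply: leq_trans (_ : q * q <= _)%N; [rewrite ltn_mul | nia].
  by rewrite ltnNge => /negP.
- by rewrite /S /= leq_maxr.
Qed.

(** * Square classes of abscissas *)

Definition squarefree (d : nat) : Prop :=
  forall q, prime q -> ~~ (q ^ 2 %| d)%N.

Lemma squarefree_part (n : nat) : (0 < n)%N ->
  exists d r, [/\ n = (d * r ^ 2)%N, (0 < d)%N & squarefree d].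
Proof.
elim/ltn_ind: n => n IH n0.
have [/hasP[q]|/hasPn nq] := boolP (has (fun q => q ^ 2 %| n)%N (primes n)).
  rewrite mem_primes => /and3P[pq _ _] /dvdnP[m em].
  have q1 := prime_gt1 pq; have m0 : (0 < m)%N by case: m em n0 => // ->.
  have [|d [r [ed d0 sd]]] := IH m _ m0.
    by rewrite em -[X in (X < _)%N]muln1 ltn_pmul2l // -(expn0 q) ltn_exp2l.
  by exists d, (r * q)%N; split=> //; rewrite em ed expnMn mulnA.
exists n, 1%N; split=> //; first by rewrite muln1.
move=> q pq; apply/negP => dq; have := nq q; rewrite dq mem_primes pq n0.
by rewrite (dvdn_trans _ dq) ?dvdn_exp // => /(_ isT).
Qed.

Lemma squarefree_prime p : prime p -> squarefree p.
Proof.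
move=> pp q pq; apply/negP => dq.
have /eqP e : q == p.
  by rewrite -dvdn_prime2 //; apply: dvdn_trans dq; apply: dvdn_exp.
have p1 := prime_gt1 pp; have := dvdn_leq (prime_gt0 pp) dq.
by rewrite e -[X in (_ <= X)%N]expn1 leq_exp2l.
Qed.

Lemma squarefree1 : squarefree 1.
Proof.
by move=> q pq; rewrite dvdn1 -(expn0 q) eqn_exp2l // prime_gt1.
Qed.

(** The exponent is the boolean [q %| d] read as 0 or 1, so square classes can later be split by
    cases on booleans. *)
Lemma squarefree_prod (s : seq nat) d : (0 < d)%N -> squarefree d ->
  uniq s -> all prime s -> (forall q, prime q -> q %| d -> q \in s)%N ->
  d = (\prod_(q <- s) q ^ (q %| d))%N.
Proof.
elim: s d => [|q s IH] d d0 sd /=.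
  move=> _ _ h; rewrite big_nil; apply/eqP; rewrite eqn_leq d0 andbT leqNgt.
  by apply/negP => d1; have := h _ (pdiv_prime d1) (pdiv_dvd d).
move=> /andP[nqs us] /andP[pq ps] h; rewrite big_cons.
have [/dvdnP[d' ed]|ndq] := boolP (q %| d)%N; last first.
  rewrite mul1n; apply: IH => // r pr rd; have := h r pr rd.
  by rewrite inE => /orP[/eqP er|//]; rewrite -er rd in ndq.
have d'0 : (0 < d')%N by case: d' ed d0 => // ->.
have nq : ~~ (q %| d')%N.
  apply/negP => /dvdnP[c ec]; have := sd q pq.
  by rewrite ed ec -mulnA dvdn_mull.
rewrite {1}ed mulnC expn1; congr muln.
rewrite [LHS]IH //.
- rewrite big_seq [RHS]big_seq; apply: eq_bigr => r rs; congr (r ^ nat_of_bool _)%N.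
  have pr := allP ps _ rs; rewrite ed Euclid_dvdM // (dvdn_prime2 pr pq).
  have /negPf -> : r != q by apply: contraNneq nqs => <-.
  by rewrite orbF.
- move=> r pr; have := sd r pr; apply: contra => dr.
  by rewrite ed dvdn_mulr.
- move=> r pr rd; have := h r pr; rewrite ed dvdn_mulr // inE => /(_ isT).
  by case/orP=> // /eqP er; rewrite er in rd; rewrite rd in nq.
Qed.

Lemma logn_odd_squarefree q d r : prime q -> (0 < d)%N -> (0 < r)%N ->
  squarefree d -> (q %| d)%N -> odd (logn q (d * r ^ 2)).
Proof.
move=> pq d0 r0 sd qd; rewrite lognM ?expn_gt0 ?r0 // lognX oddD oddM /= addbF.
have := sd q pq; rewrite pfactor_dvdn // -ltnNge ltnS => h.
suff -> : logn q d = 1%N by [].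
by apply/eqP; rewrite eqn_leq h logn_gt0 mem_primes pq d0.
Qed.

(** Write x = m / n in lowest terms and take for d the squarefree part of |m n|. The equation makes
    m n N a rational square, with N = m^2 + a m n + b n^2, so a prime dividing d divides N. It also
    divides exactly one of m and n: if n, then m^2 as well, which is absurd; if m, then b n^2 and
    hence b. *)
Lemma curve_squareclass (a b : int) (x y : rat) : x != 0 -> y != 0 ->
  y ^+ 2 = x ^+ 3 + a%:Q * x ^+ 2 + b%:Q * x ->
  exists (d : nat) (z : rat),
    [/\ (0 < d)%N, squarefree d, z != 0, `|x| = d%:R * z ^+ 2
      & forall q, prime q -> (q %| d)%N -> (q %| `|b|)%N].
Proof.
move=> x0 y0 hy.
set m := numq x; set n := denq x; set u := numq y; set v := denq y.
have m0 : m != 0 by rewrite numq_eq0.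
have n0 : n != 0 by exact: denq_neq0.
have u0 : u != 0 by rewrite numq_eq0.
have v0 : v != 0 by exact: denq_neq0.
have [mQ nQ vQ] : [/\ m%:Q != 0, n%:Q != 0 & v%:Q != 0] by rewrite !intr_eq0.
pose N := m ^+ 2 + a * m * n + b * n ^+ 2.
have E : (u * n ^+ 2) ^+ 2 = v ^+ 2 * ((m * n) * N).
  apply: (@intr_inj rat); rewrite /N !(rmorphXn, rmorphM, rmorphD) /=.
  have -> : u%:~R = y * v%:~R by exact: numqE.
  have -> : m%:~R = x * n%:~R by exact: numqE.
  rewrite !exprMn hy; ring.
have N0 : N != 0.
  apply: contra_eq_neq E => ->; rewrite !mulr0.
  by rewrite expf_neq0 ?mulf_neq0 ?expf_neq0.
have K0 : (0 < `|(m * n)%R|)%N by rewrite absz_gt0 mulf_neq0.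
have [d [r [ed d0 sd]]] := squarefree_part K0.
have r0 : (0 < r)%N by case: r ed K0 => [->|//]; rewrite muln0.
exists d, (r%:R / n%:Q); split=> //.
- by rewrite mulf_neq0 ?invr_eq0 // pnatr_eq0 -lt0n.
- have -> : x = (m * n)%:Q / n%:Q ^+ 2.
    by rewrite intrM -{1}(divq_num_den x) -/m -/n; field.
  rewrite normrM normfV (ger0_norm (_ : 0 <= n%:Q ^+ 2)) ?sqr_ge0 //.
  rewrite -intr_norm -abszE ed expr_div_n mulrA; congr (_ / _).
  by rewrite -pmulrn natrM natrX.
move=> q pq qd.
have od := logn_odd_squarefree pq d0 r0 sd qd; rewrite -ed in od.
(* The valuations of m n and N at q have an even sum, and that of m n is odd. *)
have qN : (q %| `|N|)%N.
  have : odd (logn q `|N|).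
    have := congr1 absz E.
    rewrite abszX [RHS]abszM [`|(m * n * N)%R|%N]abszM abszX.
    move=> /(congr1 (fun t => odd (logn q t))); rewrite lognX oddM.
    rewrite lognM ?expn_gt0 ?muln_gt0 ?absz_gt0 ?v0 ?mulf_neq0 //.
    rewrite lognX oddD oddM /= lognM ?absz_gt0 ?mulf_neq0 // oddD od /=.
    by case: odd.
  case e: (logn q _) => [|k] // _; apply/dvdn_trans: (pfactor_dvdnn q `|N|).
  by rewrite e expnS dvdn_mulr.
have qmn : (q %| `|m|)%N || (q %| `|n|)%N.
  by rewrite -Euclid_dvdM // -abszM ed dvdn_mulr.
have cop : coprime `|m| `|n| by exact: coprime_num_den.
have nmn : (q %| `|m|)%N -> (q %| `|n|)%N -> False.
  move=> qm qn; have : (q %| 1)%N by rewrite -(eqP cop) dvdn_gcd qm.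
  by rewrite dvdn1 => /eqP e1; rewrite e1 in pq.
have dz (t : int) : (q %| `|t|)%N = (q%:Z %| t)%Z by [].
move: qmn qN nmn; rewrite !dz => qmn qN nmn.
have pz (s t : int) : (q%:Z %| s * t)%Z = (q%:Z %| s)%Z || (q%:Z %| t)%Z.
  by rewrite -!dz abszM Euclid_dvdM.
case/orP: qmn => [qm|qn].
  have : (q%:Z %| b * n ^+ 2)%Z.
    have -> : b * n ^+ 2 = N - m * (m + a * n) by rewrite /N; ring.
    by rewrite rpredB // dvdz_mulr.
  rewrite pz expr2 pz orbb => /orP[//|qn].
  by case: (nmn qm qn).
have : (q%:Z %| m ^+ 2)%Z.
  have -> : m ^+ 2 = N - n * (a * m + b * n) by rewrite /N; ring.
  by rewrite rpredB // dvdz_mulr.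
by rewrite expr2 pz orbb => qm; case: (nmn qm qn).
Qed.

(** * Quartics without 2-adic or 7-adic points *)

(** The square of any prime in the denominator of w would divide c. *)
Lemma int_of_scaled_square (c : nat) (T : int) (w : rat) :
  squarefree c -> c%:R * w ^+ 2 = T%:Q -> exists N : int, w = N%:Q.
Proof.
move=> sc hw; exists (numq w); rewrite -{1}(divq_num_den w).
suff -> : denq w = 1 by rewrite divr1.
have E : c%:Z * numq w ^+ 2 = T * denq w ^+ 2.
  apply: (@intr_inj rat); rewrite !(rmorphXn, rmorphM) /= numqE -hw.
  by rewrite exprMn mulrA.
apply/eqP; rewrite -absz_denq eqz_nat eqn_leq absz_gt0 denq_neq0 andbT leqNgt.
apply/negP => D1; have pq := pdiv_prime D1; have := sc _ pq.
set q := pdiv _ in pq *; have qD : (q %| `|denq w|)%N by exact: pdiv_dvd.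
have : (q ^ 2 %| c * `|numq w| ^ 2)%N.
  have -> : (c * `|numq w| ^ 2 = `|T| * `|denq w| ^ 2)%N.
    by have := congr1 absz E; rewrite [LHS]abszM [RHS]abszM !abszX.
  by rewrite dvdn_mull // dvdn_exp2r.
rewrite Gauss_dvdl => [->//|].
rewrite coprimeXl // coprimeXr // coprime_sym.
exact: coprime_dvdr qD (coprime_num_den w).
Qed.

Lemma reduced_fraction (z : rat) : exists M e : int,
  [/\ e != 0, coprimez M e & z = M%:Q / e%:Q].
Proof.
exists (numq z), (denq z); rewrite denq_neq0 divq_num_den; split=> //.
exact: coprime_num_den.
Qed.

Lemma coprimez_prime (q : nat) (M e : int) : prime q -> coprimez M e ->
  (q%:Z %| M)%Z -> (q%:Z %| e)%Z -> False.
Proof.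
move=> pq; rewrite /coprimez => /eqP cop qM qe.
have : (q%:Z %| gcdz M e)%Z by rewrite dvdz_gcd qM.
by rewrite cop dvdz1 absz_nat => /eqP e1; rewrite e1 in pq.
Qed.

Lemma prime_dvdz_mul (q : nat) (s t : int) : prime q ->
  (q%:Z %| s * t)%Z = (q%:Z %| s)%Z || (q%:Z %| t)%Z.
Proof. by move=> pq; rewrite !dvdzE abszM Euclid_dvdM. Qed.

Lemma prime_dvdz_sqr (q : nat) (s : int) : prime q ->
  (q%:Z %| s ^+ 2)%Z = (q%:Z %| s)%Z.
Proof. by move=> pq; rewrite expr2 prime_dvdz_mul // orbb. Qed.

(** * Squares modulo 8 and 7, and the local obstructions *)

Lemma parity_cases (u : int) :
  (exists m, u = 2 * m) \/ exists t, u ^+ 2 = 8 * t + 1.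
Proof.
have [->|->] : u = 2 * (u %/ 2)%Z \/ u = 2 * (u %/ 2)%Z + 1 by lia.
  by left; eexists.
set m := (u %/ 2)%Z; right.
have [->|->] : m = 2 * (m %/ 2)%Z \/ m = 2 * (m %/ 2)%Z + 1 by lia.
  by exists (2 * (m %/ 2)%Z ^+ 2 + (m %/ 2)%Z); ring.
by exists (2 * (m %/ 2)%Z ^+ 2 + 3 * (m %/ 2)%Z + 1); ring.
Qed.

Lemma sqr_mod8 (u : int) : exists c,
  [\/ u ^+ 2 = 8 * c, u ^+ 2 = 8 * c + 1 | u ^+ 2 = 8 * c + 4].
Proof.
have [[m ->]|[t ->]] := parity_cases u; last by exists t; constructor 2.
have [[n ->]|[t et]] := parity_cases m.
  by exists (2 * n ^+ 2); constructor 1; ring.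
by exists (4 * t); constructor 3; rewrite exprMn et; ring.
Qed.

Lemma sqr_mod7 (u : int) : exists c,
  [\/ u ^+ 2 = 7 * c, u ^+ 2 = 7 * c + 1, u ^+ 2 = 7 * c + 2 | u ^+ 2 = 7 * c + 4].
Proof.
set q := (u %/ 7)%Z.
have : u = 7 * q \/ (u = 7 * q + 1 \/ u = 7 * q + 6) \/
  (u = 7 * q + 3 \/ u = 7 * q + 4) \/ (u = 7 * q + 2 \/ u = 7 * q + 5) by lia.
case=> [->|[[->|->]|[[->|->]|[->|->]]]].
- by exists (7 * q ^+ 2); constructor 1; ring.
- by exists (7 * q ^+ 2 + 2 * q); constructor 2; ring.
- by exists (7 * q ^+ 2 + 12 * q + 5); constructor 2; ring.
- by exists (7 * q ^+ 2 + 6 * q + 1); constructor 3; ring.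
- by exists (7 * q ^+ 2 + 8 * q + 2); constructor 3; ring.
- by exists (7 * q ^+ 2 + 4 * q); constructor 4; ring.
- by exists (7 * q ^+ 2 + 10 * q + 3); constructor 4; ring.
Qed.

Lemma mul_1mod8 (x y : int) : (exists s, x = 8 * s + 1) ->
  (exists t, y = 8 * t + 1) -> exists c, x * y = 8 * c + 1.
Proof. by move=> [s ->] [t ->]; exists (8 * s * t + s + t); ring. Qed.

Lemma mul_3mod8_sqr (p u : int) : (p = 3 %[mod 8])%Z -> exists c,
  p * u ^+ 2 = 8 * c \/ p * u ^+ 2 = 8 * c + 3 \/ p * u ^+ 2 = 8 * c + 4.
Proof.
move=> hp; have -> : p = 8 * (p %/ 8)%Z + 3 by lia.
set a := (p %/ 8)%Z; have [c [] ->] := sqr_mod8 u.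
- by exists (8 * a * c + 3 * c); left; ring.
- by exists (8 * a * c + 3 * c + a); right; left; ring.
- by exists (8 * a * c + 3 * c + 4 * a + 1); right; right; ring.
Qed.

Lemma mul_3mod8_odd (p x : int) : (p = 3 %[mod 8])%Z ->
  (exists c, x = 8 * c + 1) -> exists c, p * x = 8 * c + 3.
Proof.
move=> hp [c ->]; have -> : p = 8 * (p %/ 8)%Z + 3 by lia.
by exists (8 * (p %/ 8)%Z * c + 3 * c + (p %/ 8)%Z); ring.
Qed.

(** The left side is 0, 3 or 4 modulo 8. The right side is 1 modulo 4 for M odd and e even, and 6
    modulo 8 for both odd. For M even and e odd, N is even and a factor 4 cancels: what remains is 1
    modulo 8 if M / 2 is odd; otherwise 4 cancels once more and leaves 2, 6 or 7 modulo 8. *)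
Lemma two_adic_quartic_int (p k N M e : int) :
  (p = 3 %[mod 8])%Z -> (k = 1 %[mod 8])%Z -> coprimez M e ->
  p * N ^+ 2 <> M ^+ 4 - 11 * k * M ^+ 2 * e ^+ 2 + 32 * k ^+ 2 * e ^+ 4.
Proof.
move=> hp hk cop E.
have k1 : exists l, k = 8 * l + 1 by exists (k %/ 8)%Z; lia.
have pw4 (x : int) : x ^+ 4 = x ^+ 2 * x ^+ 2 by ring.
have [[m em]|Modd] := parity_cases M; have [[f ef]|eodd] := parity_cases e.
- by apply: (@coprimez_prime 2 _ _ isT cop); apply/dvdzP;
     [exists m | exists f]; rewrite mulrC.
- have [[n en]|Nodd] := parity_cases N; last first.
    have [c ec] := mul_3mod8_odd hp Nodd; rewrite ec em in E.
    have : 8 * c + 3 = 2 * (8 * m ^+ 4 - 22 * k * m ^+ 2 * e ^+ 2 + 16 * k ^+ 2 * e ^+ 4).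
      by rewrite E; ring.
    by move: (8 * m ^+ 4 - _ + _) => t; lia.
  have {}E : p * n ^+ 2 =
      4 * (m ^+ 2 * m ^+ 2) - 11 * (k * m ^+ 2 * e ^+ 2) + 8 * (k ^+ 2 * e ^+ 4).
    apply: (@mulfI _ 4) => //; transitivity (p * N ^+ 2); first by rewrite en; ring.
    by rewrite E em; ring.
  have [[j ej]|modd] := parity_cases m; last first.
    have [c1 h1] := mul_1mod8 modd modd.
    have [c2 h2] := mul_1mod8 (mul_1mod8 k1 modd) eodd.
    have [c3 h3] := mul_3mod8_sqr n hp.
    by move: h3; rewrite E h1 h2; move: (k ^+ 2 * e ^+ 4) => t; lia.
  have [[n' en']|nodd] := parity_cases n; last first.
    have [c ec] := mul_3mod8_odd hp nodd; rewrite ec ej in E.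
    have : 8 * c + 3 = 2 * (32 * j ^+ 4 - 22 * k * j ^+ 2 * e ^+ 2 + 4 * k ^+ 2 * e ^+ 4).
      by rewrite E; ring.
    by move: (32 * j ^+ 4 - _ + _) => t; lia.
  have {}E : p * n' ^+ 2 =
      16 * j ^+ 4 - 11 * (k * j ^+ 2 * e ^+ 2) + 2 * (k * k * (e ^+ 2 * e ^+ 2)).
    apply: (@mulfI _ 4) => //; transitivity (p * n ^+ 2); first by rewrite en'; ring.
    by rewrite E ej; ring.
  have [c1 h1] := mul_1mod8 (mul_1mod8 k1 k1) (mul_1mod8 eodd eodd).
  have [c3 h3] := mul_3mod8_sqr n' hp.
  have [[i ei]|jodd] := parity_cases j.
    have h2 : k * j ^+ 2 * e ^+ 2 = 4 * (k * i ^+ 2 * e ^+ 2) by rewrite ei; ring.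
    move: h3; rewrite E h1 h2.
    by move: (k * i ^+ 2 * e ^+ 2) (j ^+ 4) => t t'; lia.
  have [c2 h2] := mul_1mod8 (mul_1mod8 k1 jodd) eodd.
  by move: h3; rewrite E h1 h2; move: (j ^+ 4) => t; lia.
- have [c1 h1] := mul_1mod8 Modd Modd; have [c3 h3] := mul_3mod8_sqr N hp.
  move: h3; rewrite {}E pw4 h1 ef.
  have -> : 8 * c1 + 1 - 11 * k * M ^+ 2 * (2 * f) ^+ 2 + 32 * k ^+ 2 * (2 * f) ^+ 4
     = 4 * (2 * c1 - 11 * k * M ^+ 2 * f ^+ 2 + 128 * k ^+ 2 * f ^+ 4) + 1 by ring.
  by move: (2 * c1 - _ + _) => t; lia.
- have [c1 h1] := mul_1mod8 Modd Modd.
  have [c2 h2] := mul_1mod8 (mul_1mod8 k1 Modd) eodd.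
  have [c3 h3] := mul_3mod8_sqr N hp.
  move: h3; rewrite {}E pw4 h1.
  have -> : 8 * c1 + 1 - 11 * k * M ^+ 2 * e ^+ 2 + 32 * k ^+ 2 * e ^+ 4 =
    8 * c1 + 1 - 11 * (k * M ^+ 2 * e ^+ 2) + 8 * (4 * k ^+ 2 * e ^+ 4) by ring.
  by rewrite h2; move: (4 * k ^+ 2 * e ^+ 4) => t; lia.
Qed.

(** Substituting x = p z^2 into E with D = p k leads to this quartic, so the class p does not occur
    on E. *)
Lemma two_adic_quartic (p : nat) (k : int) (z w : rat) :
  prime p -> p = 3 %[mod 8] -> (k = 1 %[mod 8])%Z ->
  p%:R * w ^+ 2 <> z ^+ 4 - 11 * k%:Q * z ^+ 2 + 32 * k%:Q ^+ 2.
Proof.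
move=> pp hp hk; have [M [e [e0 cop ->]]] := reduced_fraction z => E.
have eQ : e%:Q != 0 by rewrite intr_eq0.
pose T := M ^+ 4 - 11 * k * M ^+ 2 * e ^+ 2 + 32 * k ^+ 2 * e ^+ 4.
have ET : p%:R * (w * e%:Q ^+ 2) ^+ 2 = T%:Q.
  rewrite exprMn mulrA E /T !(rmorphB, rmorphD, rmorphM, rmorphXn) /=.
  by field.
have [N eN] := int_of_scaled_square (squarefree_prime pp) ET.
apply: (@two_adic_quartic_int p k N M e) => //; first by lia.
by apply: (@intr_inj rat); rewrite -[RHS]ET eN rmorphM rmorphXn.
Qed.

(** Such k are squares modulo 7, and squares are closed under products. *)
Lemma mul_124mod7_sqr (u k : int) :
  [\/ (k = 1 %[mod 7])%Z, (k = 2 %[mod 7])%Z | (k = 4 %[mod 7])%Z] -> exists c,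
  [\/ k * u ^+ 2 = 7 * c, k * u ^+ 2 = 7 * c + 1, k * u ^+ 2 = 7 * c + 2
    | k * u ^+ 2 = 7 * c + 4].
Proof.
move=> hk; set l := (k %/ 7)%Z.
have : k = 7 * l + 1 \/ k = 7 * l + 2 \/ k = 7 * l + 4 by case: hk; lia.
have [c hc] := sqr_mod7 u; case: hc => -> [->|[->|->]].
- by exists ((7 * l + 1) * c); constructor 1; ring.
- by exists ((7 * l + 2) * c); constructor 1; ring.
- by exists ((7 * l + 4) * c); constructor 1; ring.
- by exists ((7 * l + 1) * c + l); constructor 2; ring.
- by exists ((7 * l + 2) * c + l); constructor 3; ring.
- by exists ((7 * l + 4) * c + l); constructor 4; ring.
- by exists ((7 * l + 1) * c + 2 * l); constructor 3; ring.
- by exists ((7 * l + 2) * c + 2 * l); constructor 4; ring.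
- by exists ((7 * l + 4) * c + 2 * l + 1); constructor 2; ring.
- by exists ((7 * l + 1) * c + 4 * l); constructor 4; ring.
- by exists ((7 * l + 2) * c + 4 * l + 1); constructor 2; ring.
- by exists ((7 * l + 4) * c + 4 * l + 2); constructor 3; ring.
Qed.

(* Modulo 7 the right-hand side is (z^2 + 2 k)^2, and - 2 k is a nonresidue. *)
Lemma seven_adic_quartic (c : nat) (k : int) (z w : rat) :
  ~~ (7 %| c)%N ->
  [\/ (k = 1 %[mod 7])%Z, (k = 2 %[mod 7])%Z | (k = 4 %[mod 7])%Z] ->
  7 * c%:R * w ^+ 2 <> z ^+ 4 + 11 * k%:Q * z ^+ 2 + 32 * k%:Q ^+ 2.
Proof.
move=> hc hk; have [M [e [e0 cop ->]]] := reduced_fraction z => E.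
have eQ : e%:Q != 0 by rewrite intr_eq0.
pose T := M ^+ 4 + 11 * k * M ^+ 2 * e ^+ 2 + 32 * k ^+ 2 * e ^+ 4.
have ET : 7 * c%:R * (w * e%:Q ^+ 2) ^+ 2 = T%:Q.
  rewrite exprMn mulrA E /T !(rmorphB, rmorphD, rmorphM, rmorphXn) /=.
  by field.
have [n [D [D0 copn ew]]] := reduced_fraction (w * e%:Q ^+ 2).
have DQ : D%:Q != 0 by rewrite intr_eq0.
have E' : 7 * (c%:Z * n ^+ 2) = T * D ^+ 2.
  apply: (@intr_inj rat); rewrite [RHS]rmorphM /= -ET ew !(rmorphM, rmorphXn) /=.
  by field.
have cz : ~~ (7%:Z %| c%:Z)%Z by [].
(* If 7 divided the denominator D, then 49 would divide 7 c n^2, and 7 would divide n. *)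
have T7 : (7%:Z %| T)%Z.
  have [/dvdzP[D' eD]|nD] := boolP (7%:Z %| D)%Z.
    exfalso; have : (7%:Z %| c%:Z * n ^+ 2)%Z.
      apply/dvdzP; exists (T * D' ^+ 2); apply: (@mulfI _ 7) => //.
      by rewrite E' eD; ring.
    rewrite prime_dvdz_mul // (negPf cz) prime_dvdz_sqr // => qn.
    by apply: (@coprimez_prime 7 n D) => //; apply/dvdzP; exists D'.
  have : (7%:Z %| T * D ^+ 2)%Z by rewrite -E' dvdz_mulr.
  by rewrite prime_dvdz_mul // prime_dvdz_sqr // (negPf nD) orbF.
have {T7} : (7%:Z %| (M ^+ 2 + 2 * k * e ^+ 2) ^+ 2)%Z.
  have -> : (M ^+ 2 + 2 * k * e ^+ 2) ^+ 2 =
      T - 7%:Z * (k * M ^+ 2 * e ^+ 2 + 4 * k ^+ 2 * e ^+ 4) by rewrite /T; ring.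
  by rewrite rpredB // dvdz_mulr.
rewrite prime_dvdz_sqr // => /dvdzP[g eg].
have nk : ~~ (7%:Z %| k)%Z by clear -hk; case: hk; lia.
have [qM qe] : (7%:Z %| M ^+ 2)%Z /\ (7%:Z %| e ^+ 2)%Z.
  have [t ht] := mul_124mod7_sqr e hk; have [s hs] := sqr_mod7 M.
  have {}eg : M ^+ 2 + 2 * (k * e ^+ 2) = g * 7 by rewrite -eg; ring.
  have [k7|b] := boolP (7%:Z %| k * e ^+ 2)%Z.
    split; last by move: k7; rewrite prime_dvdz_mul // (negPf nk).
    move: k7 eg => /dvdzP[c' ->]; clear; move=> eg.
    by apply/dvdzP; exists (g - 2 * c'); lia.
  exfalso; clear -hs ht eg b.
  by case: ht => ht; rewrite ht in eg *; case: hs => hs; rewrite hs in eg; lia.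
by apply: (@coprimez_prime 7 M e) => //; rewrite -prime_dvdz_sqr.
Qed.

(** * Quadratic nonresidues modulo p *)

Lemma floor_sqrt (n : nat) : exists s, (s ^ 2 <= n < s.+1 ^ 2)%N.
Proof.
elim: n => [|n [s /andP[h1 h2]]]; first by exists 0%N.
have [h|h] := ltnP n.+1 (s.+1 ^ 2); first by exists s; rewrite h (leq_trans h1).
by exists s.+1; rewrite h /= -addn1; move: h2; rewrite !expnS !expn0; nia.
Qed.

(* Thue: by pigeonhole, two of the more than p values u - r v with
   0 <= u, v <= sqrt p agree modulo p. *)
Lemma thue (p : nat) (r : int) : prime p -> exists u v : int,
  [/\ u != 0 \/ v != 0, u ^+ 2 < p%:Z, v ^+ 2 < p%:Z & (p%:Z %| u - r * v)%Z].
Proof.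
move=> pp; have [s /andP[sp ps]] := floor_sqrt p.
have p0 : p%:Z != 0 by rewrite eqz_nat -lt0n prime_gt0.
have sp' : (s ^ 2 < p)%N.
  (* A prime is not a perfect square, which gives the strict bounds on u^2 and v^2. *)
  rewrite ltn_neqAle sp andbT; apply/negP => /eqP e.
  have := squarefree_prime pp; have [s1|s1] := leqP s 1.
    by move: pp; rewrite -e; case: s s1 {sp ps e} => [|[]].
  move=> /(_ _ (pdiv_prime s1)); rewrite -e => /negP; apply.
  by rewrite dvdn_exp2r // pdiv_dvd.
pose h (ij : 'I_s.+1 * 'I_s.+1) := ((ij.1%:Z - r * ij.2%:Z)%R %% p%:Z)%Z.
have hp ij : (`|h ij| < p)%N.
  rewrite -ltz_nat gez0_abs ?modz_ge0 //.
  by rewrite ltz_pmod // ltz_nat prime_gt0.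
pose g ij : 'I_p := Ordinal (hp ij).
have /injectivePn[[i j] [[i' j'] ne]] : ~~ injectiveb g.
  apply/negP => /injectiveP/leq_card; rewrite card_prod !card_ord.
  by rewrite leqNgt -[(s.+1 * s.+1)%N]/(s.+1 ^ 2)%N ps.
move=> /(congr1 val) /= /(congr1 Posz); rewrite !gez0_abs ?modz_ge0 // => /eqP.
rewrite eqz_mod_dvd /= => d.
exists (i%:Z - i'%:Z), (j%:Z - j'%:Z).
have bnd (a b : 'I_s.+1) : (a%:Z - b%:Z) ^+ 2 < p%:Z.
  apply: (@Order.POrderTheory.le_lt_trans _ _ ((s ^ 2)%N%:Z)); last by rewrite ltz_nat.
  by have := ltn_ord a; have := ltn_ord b; move: (val a) (val b) => /= x y hx hy; nia.
split; rewrite ?bnd //; last by move: d; congr (_ %| _)%Z; ring.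
apply/orP; rewrite -negb_and !subr_eq0; apply: contra ne => /andP[/eqP[ei] /eqP[ej]].
by apply/eqP; congr (_, _); apply: val_inj.
Qed.

(** If a inverts y modulo p, then x a is a square root of n modulo p, to which [thue] applies. *)
Lemma thue_form (p : nat) (n x y : int) : prime p -> ~~ (p%:Z %| y)%Z ->
  (p%:Z %| x ^+ 2 - n * y ^+ 2)%Z -> exists u v : int,
  [/\ u != 0 \/ v != 0, u ^+ 2 < p%:Z, v ^+ 2 < p%:Z
    & (p%:Z %| u ^+ 2 - n * v ^+ 2)%Z].
Proof.
move=> pp ny d.
have [[a b] ab] : exists ab : int * int, ab.1 * y + ab.2 * p%:Z = 1.
  have : coprimez y p%:Z by rewrite coprimez_sym coprimezE prime_coprime.
  by case/coprimezP => -[a b] <-; exists (a, b); rewrite /=; ring.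
rewrite /= in ab; have [u [v [uv up vp duv]]] := thue (x * a) pp.
exists u, v; split=> //.
have -> : u ^+ 2 - n * v ^+ 2 = (u - x * a * v) * (u + x * a * v)
    + v ^+ 2 * (a ^+ 2 * (x ^+ 2 - n * y ^+ 2)
      + n * (a * y - 1) * (a * y + 1)) by ring.
apply: rpredD; first exact: dvdz_mulr.
apply: dvdz_mull; apply: rpredD; first exact: dvdz_mull.
apply: dvdz_mulr; apply: dvdz_mull.
by rewrite -ab opprD addNKr rpredN dvdz_mull.
Qed.

(** Irrationality of the square root of q, by parity of q-adic valuations. *)
Lemma sqr_eq_prime_mul_sqr (q : nat) (u v : int) : prime q ->
  u ^+ 2 = q%:Z * v ^+ 2 -> u = 0 /\ v = 0.
Proof.
move=> pq E; have v0 : v = 0.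
  apply/eqP; apply/negPn/negP => v0; have q0 := prime_gt0 pq.
  have := congr1 absz E; rewrite [RHS]abszM !abszX => /(congr1 (logn q)).
  rewrite lognX absz_nat lognM ?expn_gt0 ?absz_gt0 ?v0 // lognX.
  have -> : logn q q = 1%N by rewrite logn_prime ?eqxx.
  by lia.
by move: E; rewrite v0 expr0n mulr0 => /eqP; rewrite sqrf_eq0 => /eqP.
Qed.

Lemma sqr_mod5 (u : int) : (5%:Z %| u)%Z \/ exists c,
  u ^+ 2 = 5 * c + 1 \/ u ^+ 2 = 5 * c + 4.
Proof.
set q := (u %/ 5)%Z.
have [d|[->|[->|[->|->]]]] : (5%:Z %| u)%Z \/ u = 5 * q + 1 \/ u = 5 * q + 2 \/
  u = 5 * q + 3 \/ u = 5 * q + 4 by lia.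
- by left.
- by right; exists (5 * q ^+ 2 + 2 * q); left; ring.
- by right; exists (5 * q ^+ 2 + 4 * q); right; ring.
- by right; exists (5 * q ^+ 2 + 6 * q + 1); right; ring.
- by right; exists (5 * q ^+ 2 + 8 * q + 3); left; ring.
Qed.

Lemma bounded_multiple (p k l m : int) : 0 < p ->
  l * p < k * p -> k * p < m * p -> l < k /\ k < m.
Proof. by move=> p0; rewrite !(ltr_pM2r p0). Qed.

(* In each case [thue_form] gives u^2 - n v^2 = k p with u^2, v^2 < p, hence
   finitely many k; congruences modulo 8, 7 and 5 rule them out. *)
Lemma nonresidue_m1 (p : nat) (x y : int) : prime p -> p = 3 %[mod 8] ->
  (p%:Z %| x ^+ 2 + y ^+ 2)%Z -> (p%:Z %| y)%Z.
Proof.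
move=> pp p38 d; apply/negPn/negP => ny.
have pZ0 : 0 < p%:Z by rewrite ltz_nat prime_gt0.
have [|u [v [uv up vp /dvdzP[k]]]] := @thue_form p (-1) x y pp ny.
  by rewrite mulN1r opprK.
have : 0 < u ^+ 2 + v ^+ 2.
  rewrite lt0r paddr_eq0 ?sqr_ge0 // addr_ge0 ?sqr_ge0 // !sqrf_eq0 negb_and.
  by case: uv => ->; rewrite ?orbT.
rewrite mulN1r opprK => uv0 e.
have [|| k0 k2] := @bounded_multiple p k 0 2 pZ0.
- by rewrite -e mul0r.
- by rewrite -e; clear -up vp; lia.
have k1 : k = 1 by clear -k0 k2; lia.
have [c hc] := sqr_mod8 u; have [c' hc'] := sqr_mod8 v.
by rewrite k1 in e; case: hc => h; case: hc' => h'; rewrite h h' in e; clear -e p38; lia.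
Qed.

Lemma nonresidue_2 (p : nat) (x y : int) : prime p -> p = 3 %[mod 8] ->
  (p%:Z %| x ^+ 2 - 2 * y ^+ 2)%Z -> (p%:Z %| y)%Z.
Proof.
move=> pp p38 d; apply/negPn/negP => ny.
have pZ0 : 0 < p%:Z by rewrite ltz_nat prime_gt0.
have [u [v [uv up vp /dvdzP[k e]]]] := @thue_form p 2 x y pp ny d.
have [u0 v0] := (sqr_ge0 u, sqr_ge0 v).
have [|| k0 k2] := @bounded_multiple p k (-2) 1 pZ0.
- by rewrite -e; clear -u0 vp; lia.
- by rewrite -e; clear -up v0; lia.
(* k = 0 would make 2 a rational square; k = -1 would make u^2 - 2 v^2 equal to 5 modulo 8, a value
   it never takes. *)
have {k0 k2} [k0|k1] : k = 0 \/ k = -1 by clear -k0 k2; lia.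
  have [||u1 v1] := @sqr_eq_prime_mul_sqr 2 u v => //.
    by apply/eqP; rewrite -subr_eq0 e k0 mul0r.
  by case: uv; rewrite ?u1 ?v1 eqxx.
have [c hc] := sqr_mod8 u; have [c' hc'] := sqr_mod8 v.
by rewrite k1 in e; case: hc => h; case: hc' => h'; rewrite h h' in e; clear -e p38; lia.
Qed.

Lemma nonresidue_7 (p : nat) (x y : int) : prime p -> p = 3 %[mod 8] ->
  p = 1 %[mod 7] \/ p = 2 %[mod 7] \/ p = 4 %[mod 7] ->
  (p%:Z %| x ^+ 2 - 7 * y ^+ 2)%Z -> (p%:Z %| y)%Z.
Proof.
move=> pp p38 p7 d; apply/negPn/negP => ny.
have pZ0 : 0 < p%:Z by rewrite ltz_nat prime_gt0.
have [u [v [uv up vp /dvdzP[k e]]]] := @thue_form p 7 x y pp ny d.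
have [u0 v0] := (sqr_ge0 u, sqr_ge0 v).
(* Grouped by obstruction: irrationality for 0; modulo 7, where k p is a nonresidue, for -1, -2, -4;
   modulo 8 for -3, -6; and modulo 5 for -5, where 2 is a nonresidue, so that 5 divides u, v and
   then p. *)
have kb : k = 0 \/ (k = -1 \/ k = -2 \/ k = -4) \/ (k = -3 \/ k = -6) \/ k = -5.
  have [|| k0 k2] := @bounded_multiple p k (-7) 1 pZ0.
  - by rewrite -e; clear -u0 vp; lia.
  - by rewrite -e; clear -up v0; lia.
  by clear -k0 k2; lia.
clear up vp u0 v0.
case: kb => [k0|[k7|[k8|k5]]].
- have [||u1 v1] := @sqr_eq_prime_mul_sqr 7 u v => //.
    by apply/eqP; rewrite -subr_eq0 e k0 mul0r.
  by case: uv; rewrite ?u1 ?v1 eqxx.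
- have [c hc] := sqr_mod7 u.
  by case: hc => h; rewrite h in e; clear -k7 e p7; case: k7 e => [->|[->|->]] e; lia.
- have [c hc] := sqr_mod8 u; have [c' hc'] := sqr_mod8 v.
  case: hc => h; case: hc' => h'; rewrite h h' in e; clear -e k8 p38;
    by case: k8 e => -> e; lia.
- have [du|[c hc]] := sqr_mod5 u; have [dv|[c' hc']] := sqr_mod5 v; rewrite k5 in e.
  + move/dvdzP: du dv e => [a ->] /dvdzP[b ->] e.
    have : (5 %| p)%N by clear -e; lia.
    by rewrite dvdn_prime2 // => /eqP p5; rewrite -p5 in p38.
  + by move/dvdzP: du e => [a ->] e; clear -e hc'; case: hc' e => -> e; lia.
  + by move/dvdzP: dv e => [a ->] e; clear -e hc; case: hc e => -> e; lia.
  + by clear -e hc hc'; case: hc e => ->; case: hc' => -> e; lia.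
Qed.

(** * The two twists *)

(* p is inert in Z[sqrt 2], so A^2 - 2 B^2 has even p-adic valuation. *)
Lemma norm_form_sqrt2 (p : nat) (A B N : int) (s : bool) :
  prime p -> p = 3 %[mod 8] ->
  p%:Z * N ^+ 2 = (-1) ^+ s * (A ^+ 2 - 2 * B ^+ 2) -> B = 0.
Proof.
move=> pp p38 E; apply/eqP; apply/negPn/negP => B0.
have g0 : gcdz A B != 0 by rewrite gcdz_eq0 (negPf B0) andbF.
have /dvdzP[A' eA] := dvdz_gcdl A B.
have /dvdzP[B' eB] := dvdz_gcdr A B.
set g := gcdz A B in g0 eA eB.
have cop : coprimez A' B'.
  have : (gcdn `|A'| `|B'| * `|g| = `|g|)%N by rewrite muln_gcdl -!abszM -eA -eB.
  by move/eqP; rewrite -{2}(mul1n `|g|%N) eqn_pmul2r // absz_gt0.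
pose F := A' ^+ 2 - 2 * B' ^+ 2.
have nF : ~~ (p%:Z %| F)%Z.
  apply/negP => dF; have dB := nonresidue_2 pp p38 dF.
  apply: (coprimez_prime pp cop) => //; rewrite -prime_dvdz_sqr //.
  have -> : A' ^+ 2 = F + 2 * B' ^+ 2 by rewrite /F; ring.
  by rewrite rpredD // dvdz_mull // prime_dvdz_sqr.
have F0 : F != 0 by apply: contraNneq nF => ->; rewrite dvdz0.
have {}E : p%:Z * N ^+ 2 = (-1) ^+ s * (g ^+ 2 * F).
  by rewrite E {1}eA {1}eB /F; ring.
have N0 : N != 0.
  apply: contra_eq_neq E => ->; rewrite expr0n mulr0 eq_sym.
  by rewrite !mulf_neq0 ?signr_eq0 ?expf_neq0.
(* The p-adic valuation is odd on the left and even on the right, as p does not divide F. *)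
have := congr1 (fun t => logn p `|t|) E.
rewrite abszMsign [`|(p%:Z * _)%R|%N]abszM [`|(g ^+ 2 * _)%R|%N]abszM !abszX absz_nat.
rewrite !lognM ?expn_gt0 ?absz_gt0 ?N0 ?g0 ?F0 ?prime_gt0 //.
have -> : logn p `|F| = 0%N.
  by apply/eqP; rewrite -leqn0 leqNgt logn_gt0 mem_primes pp absz_gt0 F0.
have -> : logn p p = 1%N by rewrite logn_prime ?eqxx.
by clear; lia.
Qed.

(** Clearing denominators gives a norm form with B = m e^2, which [norm_form_sqrt2] forces to
    vanish. *)
Lemma no_quartic_point_pm_p (p : nat) (l m : int) (s : bool) (z w : rat) :
  prime p -> p = 3 %[mod 8] -> m != 0 ->
  p%:R * w ^+ 2 <> (-1) ^+ s * ((z ^+ 2 + l%:Q) ^+ 2 - 2 * m%:Q ^+ 2).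
Proof.
move=> pp p38 m0; have [M [e [e0 cop ->]]] := reduced_fraction z => E.
have eQ : e%:Q != 0 by rewrite intr_eq0.
pose T := (-1) ^+ s * ((M ^+ 2 + l * e ^+ 2) ^+ 2 - 2 * (m * e ^+ 2) ^+ 2).
have ET : p%:R * (w * e%:Q ^+ 2) ^+ 2 = T%:Q.
  rewrite exprMn mulrA E /T !(rmorphB, rmorphD, rmorphM, rmorphXn, rmorphN) /=.
  by field.
have [N eN] := int_of_scaled_square (squarefree_prime pp) ET.
have : p%:Z * N ^+ 2 = T.
  by apply: (@intr_inj rat); rewrite -[RHS]ET eN rmorphM rmorphXn.
move/(norm_form_sqrt2 pp p38)/eqP.
by rewrite mulf_eq0 sqrf_eq0 (negPf m0) (negPf e0).
Qed.

(** This excludes the class -1 on E'. Modulo p the equation reads N^2 = - M^4, so p divides M and N.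
    After division by p^2 it reads N'^2 = 7 (k e^2)^2 modulo p, so p divides e as well. *)
Lemma no_quartic_point_m1 (p : nat) (k : int) (z w : rat) :
  prime p -> p = 3 %[mod 8] ->
  p = 1 %[mod 7] \/ p = 2 %[mod 7] \/ p = 4 %[mod 7] -> ~~ (p%:Z %| k)%Z ->
  w ^+ 2 <> - z ^+ 4 + 22 * (p%:R * k%:Q) * z ^+ 2 + 7 * (p%:R * k%:Q) ^+ 2.
Proof.
move=> pp p38 p7 pk; have [M [e [e0 cop ->]]] := reduced_fraction z => E.
have eQ : e%:Q != 0 by rewrite intr_eq0.
pose T := - M ^+ 4 + 22 * (p%:Z * k) * M ^+ 2 * e ^+ 2 + 7 * (p%:Z * k) ^+ 2 * e ^+ 4.
have ET : 1%:R * (w * e%:Q ^+ 2) ^+ 2 = T%:Q.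
  rewrite exprMn E /T !(rmorphB, rmorphD, rmorphM, rmorphXn, rmorphN) /=.
  by field.
have [N eN] := int_of_scaled_square squarefree1 ET.
have {ET eN} ET : N ^+ 2 = T.
  by apply: (@intr_inj rat); rewrite -[RHS]ET eN mul1r rmorphXn.
have dM : (p%:Z %| M)%Z.
  rewrite -prime_dvdz_sqr //; apply: (@nonresidue_m1 p N (M ^+ 2)) => //.
  rewrite ET; apply/dvdzP; exists (22 * k * M ^+ 2 * e ^+ 2 + 7 * p%:Z * k ^+ 2 * e ^+ 4).
  by rewrite /T; ring.
have /dvdzP[M' eM] := dM.
have dN : (p%:Z %| N)%Z.
  rewrite -prime_dvdz_sqr // ET /T eM; apply/dvdzP.
  exists (- p%:Z ^+ 3 * M' ^+ 4 + 22 * p%:Z ^+ 2 * k * M' ^+ 2 * e ^+ 2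
    + 7 * p%:Z * k ^+ 2 * e ^+ 4).
  by ring.
have /dvdzP[N' eN] := dN.
have p0 : p%:Z != 0 by rewrite eqz_nat -lt0n prime_gt0.
have E' : N' ^+ 2 = - p%:Z ^+ 2 * M' ^+ 4 + 22 * p%:Z * k * M' ^+ 2 * e ^+ 2
    + 7 * k ^+ 2 * e ^+ 4.
  apply: (mulfI (expf_neq0 2 p0)); transitivity (N ^+ 2); first by rewrite eN; ring.
  by rewrite ET /T eM; ring.
apply: (coprimez_prime pp cop dM).
suff : (p%:Z %| k * e ^+ 2)%Z by rewrite prime_dvdz_mul // (negPf pk) prime_dvdz_sqr.
apply: (@nonresidue_7 p N') => //; apply/dvdzP.
exists (- p%:Z * M' ^+ 4 + 22 * k * M' ^+ 2 * e ^+ 2).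
by rewrite E'; ring.
Qed.

Lemma prime_dvd_square_twist (p : nat) (c : nat) (k : int) (q : nat) :
  prime p -> prime q -> (q %| `|(c%:Z * (p%:Z * k) ^+ 2)%R|)%N ->
  [\/ (q %| c)%N, q = p | (q %| `|k|)%N].
Proof.
move=> pp pq; rewrite abszM abszX abszM !absz_nat Euclid_dvdM // Euclid_dvdX // andbT.
rewrite Euclid_dvdM // (dvdn_prime2 pq pp).
by case/or3P => [|/eqP|]; [constructor 1 | constructor 2 | constructor 3].
Qed.

(** Up to the sign of the ordinate this is the sum with (0, 0); it multiplies the square class of
    the abscissa by that of b. *)
Lemma translate_by_two_torsion (a b x y : rat) : x != 0 ->
  y ^+ 2 = x ^+ 3 + a * x ^+ 2 + b * x ->
  (b * y / x ^+ 2) ^+ 2 = (b / x) ^+ 3 + a * (b / x) ^+ 2 + b * (b / x).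
Proof. by move=> x0 hy; rewrite expr_div_n exprMn hy; field. Qed.

(** The possible classes are generated by -1, 7 and p. Translation by (0, 0), of class -7, removes
    the factor 7, and [obstruct] rules out -1, p and -p. *)
Lemma isogenous_twist_descent (p : nat) (k : int) (X Y : rat) :
  prime p -> p = 3 %[mod 8] ->
  p = 1 %[mod 7] \/ p = 2 %[mod 7] \/ p = 4 %[mod 7] ->
  k = 1 \/ k = -7 -> X != 0 -> Y != 0 ->
  let D := p%:R * k%:Q in
  Y ^+ 2 = X ^+ 3 + 22 * D * X ^+ 2 + (- 7 * D ^+ 2) * X ->
  exists v, X = v ^+ 2 \/ (- 7 * D ^+ 2) / X = v ^+ 2.
Proof.
move=> pp p38 p7 hk X0 Y0 D hY.
have p0 : (p%:R : rat) != 0 by rewrite pnatr_eq0 -lt0n prime_gt0.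
have k0 : k != 0 by case: hk => ->.
have kQ : k%:Q != 0 by rewrite intr_eq0.
have D0 : D != 0 by rewrite mulf_neq0.
have p77 : p != 7 by apply/eqP => e; move: p38; rewrite e.
have pk : ~~ (p%:Z %| k)%Z.
  case: hk => ->; rewrite dvdzE ?absz_nat.
    by rewrite dvdn1 neq_ltn prime_gt1 ?orbT.
  by rewrite (dvdn_prime2 pp).
have obstruct (X' Y' z : rat) (s j : bool) : z != 0 ->
    Y' ^+ 2 = X' ^+ 3 + 22 * D * X' ^+ 2 + (- 7 * D ^+ 2) * X' ->
    X' = (-1) ^+ s * p%:R ^+ j * z ^+ 2 -> X' = z ^+ 2.
  move=> z0 hY' eX; case: j eX => /= eX.
    (* Completing the square in z^4 +- 22 k z^2 - 7 k^2, where 121 + 7 = 2 * 8^2. *)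
    exfalso; apply: (@no_quartic_point_pm_p p ((-1) ^+ s * 11 * k) (8 * k) s z
      (Y' / (p%:R ^+ 2 * z))) => //; first by rewrite mulf_neq0.
    rewrite expr_div_n hY' eX /D !(rmorphM, rmorphXn, rmorphN) /=.
    by case: (s); field; rewrite ?z0 ?p0.
  case: s eX => /= eX; last by rewrite eX !mul1r.
  exfalso; apply: (@no_quartic_point_m1 p k z (Y' / z)) => //.
  rewrite expr_div_n hY' eX /D.
  by field; rewrite ?z0 ?p0.
have [|d [z [d0 sd z0 hd dq]]] := @curve_squareclass (22 * (p%:Z * k))
  (- (7%:Z * (p%:Z * k) ^+ 2)) X Y X0 Y0.
  by rewrite hY /D !(rmorphM, rmorphXn, rmorphN) /=; ring.
have ed : d = (\prod_(q <- [:: 7; p]) q ^ (q %| d))%N.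
  apply: squarefree_prod => //=; first by rewrite inE eq_sym p77.
    by rewrite pp.
  move=> q pq /(dq _ pq); rewrite abszN => /(@prime_dvd_square_twist _ 7 _ _ pp pq).
  rewrite !inE => -[h|->|h]; rewrite ?eqxx ?orbT //.
    by rewrite -(dvdn_prime2 pq) // h.
  case: hk h => ->; first by rewrite dvdn1 => /eqP e; rewrite e in pq.
  by rewrite -[`|_|%N]/7%N (dvdn_prime2 pq) // => ->.
rewrite big_cons big_seq1 in ed.
have [s eX] : exists s : bool, X = (-1) ^+ s * (d%:R * z ^+ 2).
  by exists (X < 0); rewrite -hd mulr_sign_norm.
move: eX; rewrite {1}ed; set j := (p %| d)%N => eX.
have j0 : (p%:R ^+ j : rat) != 0 by rewrite expf_neq0.
move: eX; case: (7 %| d)%N => eX; last first.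
  exists z; left; apply: (obstruct X Y z s j) => //.
  by rewrite eX mul1n natrX mulrA.
exists (D / (p%:R ^+ j * z)); right.
apply: (obstruct _ (- 7 * D ^+ 2 * Y / X ^+ 2) _ (~~ s) j).
- by rewrite !mulf_neq0 ?invr_eq0 ?mulf_neq0.
- exact: translate_by_two_torsion.
- by rewrite eX natrM !natrX; case: (s); field; rewrite ?z0 ?j0.
Qed.

(** The class is positive and generated by 2, p and, only if k = -7, by 7. Translation by (0, 0), of
    class 32 and so of class 2, removes the factor 2, and [obstruct] rules out p, 7 and 7 p. *)
Lemma twist_descent (p : nat) (k : int) (x y : rat) :
  prime p -> p = 3 %[mod 8] ->
  p = 1 %[mod 7] \/ p = 2 %[mod 7] \/ p = 4 %[mod 7] ->
  k = 1 \/ k = -7 -> x != 0 ->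
  let D := p%:R * k%:Q in
  y ^+ 2 = x ^+ 3 + (- 11 * D) * x ^+ 2 + (32 * D ^+ 2) * x ->
  exists u, x = u ^+ 2 \/ (32 * D ^+ 2) / x = u ^+ 2.
Proof.
move=> pp p38 p7 hk x0 D hy.
have p0 : (p%:R : rat) != 0 by rewrite pnatr_eq0 -lt0n prime_gt0.
have k0 : k != 0 by case: hk => ->.
have kQ : k%:Q != 0 by rewrite intr_eq0.
have D0 : D != 0 by rewrite mulf_neq0.
have p77 : p != 7 by apply/eqP => e; move: p38; rewrite e.
have p22 : p != 2 by apply/eqP => e; move: p38; rewrite e.
have obstruct (x' y' z : rat) (i j : bool) : (i -> k = -7) -> z != 0 ->
    y' ^+ 2 = x' ^+ 3 + (- 11 * D) * x' ^+ 2 + (32 * D ^+ 2) * x' ->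
    x' = 7 ^+ i * p%:R ^+ j * z ^+ 2 -> x' = z ^+ 2.
  (* In order: 7 p and 7 fail at 7 (for the class 7 because p is a square modulo 7), p fails at 2
     since k is 1 modulo 8, and the class 1 remains. *)
  move=> ik z0 hy' ex; case: i ik ex => [/(_ isT) ik|_] /=; case: j => /= ex.
  - exfalso; apply: (@seven_adic_quartic p 1 z (y' / (49 * p%:R ^+ 2 * z))).
    + by rewrite (dvdn_prime2 _ pp) // eq_sym.
    + by constructor 1.
    + rewrite expr_div_n hy' ex /D ik.
      by field; rewrite ?z0 ?p0.
  - exfalso; apply: (@seven_adic_quartic 1 p%:Z z (y' / (49 * z))) => //.
    + by case: p7 => [h|[h|h]]; [constructor 1|constructor 2|constructor 3]; clear -h; lia.
    + rewrite expr_div_n hy' ex /D ik.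
      by field; rewrite ?z0 ?p0.
  - exfalso; apply: (@two_adic_quartic p k z (y' / (p%:R ^+ 2 * z))) => //.
      by case: hk => ->.
    rewrite expr_div_n hy' ex /D.
    by field; rewrite ?z0 ?p0.
  - by rewrite ex !mul1r.
(* The quadratic factor has discriminant -7 D^2, so it is positive and x >= 0. *)
have fac : y ^+ 2 = x * ((x - 11 * D / 2) ^+ 2 + 7 * D ^+ 2 / 4) by rewrite hy; field.
have pos : 0 < (x - 11 * D / 2) ^+ 2 + 7 * D ^+ 2 / 4.
  have : 0 < D ^+ 2 by rewrite exprn_even_gt0.
  by have := sqr_ge0 (x - 11 * D / 2); move: (_ ^+ 2) (D ^+ 2) => t t'; clear; lra.
have xpos : 0 <= x by rewrite -(pmulr_lge0 x pos) -fac sqr_ge0.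
have y0 : y != 0.
  by rewrite -sqrf_eq0 fac mulf_neq0 // lt0r_neq0.
have [|d [z [d0 sd z0 hd dq]]] := @curve_squareclass (- (11 * (p%:Z * k)))
  (32%:Z * (p%:Z * k) ^+ 2) x y x0 y0.
  by rewrite hy /D !(rmorphM, rmorphXn, rmorphN) /=; ring.
have {}dq q : prime q -> (q %| d)%N -> [\/ q = 2, q = p | q = 7 /\ k = -7].
  move=> pq /(dq _ pq) /(@prime_dvd_square_twist _ 32 _ _ pp pq) [h|->|h].
  - constructor 1; apply/eqP; rewrite -(dvdn_prime2 pq) //.
    by move: (h : (q %| 2 ^ 5)%N); rewrite Euclid_dvdX // andbT.
  - by constructor 2.
  - constructor 3; case: hk h => ->.
      by rewrite dvdn1 => /eqP e; rewrite e in pq.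
    by rewrite -[`|_|%N]/7%N (dvdn_prime2 pq) // => /eqP.
have ed : d = (\prod_(q <- [:: 2; 7; p]) q ^ (q %| d))%N.
  apply: squarefree_prod => //=.
  - by rewrite !inE (eq_sym 2 p) (eq_sym 7 p) (negPf p22) (negPf p77).
  - by rewrite pp.
  - by move=> q pq /(dq _ pq) [->|->|[-> _]]; rewrite !inE eqxx ?orbT.
rewrite 2!big_cons big_seq1 in ed.
have i7 : (7 %| d)%N -> k = -7.
  case/(dq 7 isT) => [//|e|[]//].
  by rewrite e eqxx in p77.
rewrite ger0_norm // in hd.
move: hd; rewrite {1}ed; move: (7 %| d)%N i7 (p %| d)%N => i i7 j hd.
have j0 : (p%:R ^+ j : rat) != 0 by rewrite expf_neq0.
have i0 : (7 ^+ i : rat) != 0 by rewrite expf_neq0.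
move: hd; case: (2 %| d)%N => hd; last first.
  exists z; left; apply: (obstruct x y z i j) => //.
  by rewrite hd mul1n natrM !natrX.
exists (4 * D / (7 ^+ i * p%:R ^+ j * z)); right.
apply: (obstruct _ (32 * D ^+ 2 * y / x ^+ 2) _ i j) => //.
- by rewrite !mulf_neq0 ?invr_eq0 ?mulf_neq0.
- exact: translate_by_two_torsion.
- by rewrite hd !natrM !natrX; field; rewrite ?z0 ?j0 ?i0.
Qed.

Lemma legendre7_mod (p : nat) : legendre p%:Z 7 = 1 ->
  p = 1 %[mod 7] \/ p = 2 %[mod 7] \/ p = 4 %[mod 7].
Proof.
rewrite /legendre; case: ifP => // p7; case: ifP => // /existsP[x /eqP hx] _.
have := congr1 (@nat_of_ord _) hx; rewrite -pmulrn val_Fp_nat // => {hx}.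
move: p7; rewrite dvdzE !absz_nat /dvdn; case: x => m.
(* Enumeration of the seven elements x of the field. *)
do 7?[case: m => [|m]] => //= _ + e; by rewrite -e; auto.
Qed.

Theorem theorem3 (p : nat) (p_prime : prime p)
    (p_mod8 : p = 3 %[mod 8]) (p_leg7 : legendre p%:Z 7 = 1) :
  has_rank (point (twist X1_14 p%:Q (primeQ_neq0 p_prime))) 0 /\
  has_rank (point (twist X1_14 (-7 * p%:Q) (m7primeQ_neq0 p_prime))) 0.
Proof.
have p7 := legendre7_mod p_leg7.
(* Both twists are treated at once as the twist by D = p k. *)
have rank0 (k : int) (E : ellcurve rat) : k = 1 \/ k = -7 ->
    ella E = -11 * (p%:R * k%:Q) -> ellb E = 32 * (p%:R * k%:Q) ^+ 2 ->
    has_rank (point E) 0.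
  move=> hk aE bE.
  have aZ : (-11 * (p%:Z * k))%:Q = - 11 * (p%:R * k%:Q).
    by rewrite !rmorphM.
  have bZ : (32 * (p%:Z * k) ^+ 2)%:Q = 32 * (p%:R * k%:Q) ^+ 2.
    by rewrite !(rmorphM, rmorphXn).
  apply: (@rank0_of_descent (-11 * (p%:Z * k)) (32 * (p%:Z * k) ^+ 2)).
  - by rewrite aZ aE.
  - by rewrite bZ bE.
  - rewrite aZ bZ => x y x0 hy.
    exact: (twist_descent p_prime p_mod8 p7 hk x0 hy).
  - have -> : - 2 * (-11 * (p%:Z * k))%:Q = 22 * (p%:R * k%:Q).
      by rewrite aZ; ring.
    have -> : (-11 * (p%:Z * k))%:Q ^+ 2 - 4 * (32 * (p%:Z * k) ^+ 2)%:Q =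
        - 7 * (p%:R * k%:Q) ^+ 2 by rewrite aZ bZ; ring.
    move=> X Y X0 Y0 hY.
    exact: (isogenous_twist_descent p_prime p_mod8 p7 hk X0 Y0 hY).
split.
- by apply: (@rank0 1); [left | rewrite rmorph1 mulr1 | rewrite rmorph1 mulr1].
- by apply: (@rank0 (-7)); [right | rewrite [p%:R * _]mulrC | rewrite [p%:R * _]mulrC].
Qed.
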